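(* Let $a^*(\tau)=\Big[4(1+2\sqrt\Delta\,\tau)(1+\frac{\tau}{16\kappa})\Big]^{-1}$. For every constant $K>0$ there is a constant $c>0$ depending only on $K$ (not on $n,d,\kappa,\Delta,\tau$ or the $f_i$) such that: if $\tau\le Kn$ and $\tau\le K\frac{1}{\sqrt\Delta}\max\{1,\frac n\kappa\}$, and if in addition, in the case $n\ge\kappa$, $\tau\le\sqrt{n\,\Delta^{-1/2}}$, then KROMAGNON with step size $\gamma=\frac{a^*(\tau)}{4L}$ and epoch size $m=\frac{32\kappa}{a^*(\tau)}$ converges geometrically with rate factor per gradient computation $\rho\ge c\min\{\frac1n,\frac1\kappa\}$, i.e. $\mathbb{E}f(\tilde x_k)-f(x^* )\le(1-\rho)^{k(2m+n)}(f(x_0)-f(x^* ))$ for all $k\ge0$. Thus its rate factor is, up to a constant factor, the one $\Omega(\min\{\frac1n,\frac1\kappa\})$ of sequential SVRG, and KROMAGNON is linearly faster than it up to a constant factor.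
   Context: Let $f(x)=\frac1n\sum_{i=1}^n f_i(x)$ on $\mathbb{R}^d$, where each $f_i$ is convex and differentiable with $L$-Lipschitz gradient $f_i'$, and $f$ is $\mu$-strongly convex ($\mu>0$). Let $\kappa:=L/\mu$ and let $x^*$ be the minimizer of $f$. $[x]_v$ denotes coordinate $v$ of $x$. For each $i$, $S_i\subseteq\{1,\dots,d\}$ is the support of $f_i'$, i.e. the set of coordinates where $f_i'$ can be nonzero. $P_{S_i}$ is the coordinate projection onto $S_i$; $p_v:=\frac1n|\{i:v\in S_i\}|$; $D$ is diagonal with entries $1/p_v$; $D_i:=P_{S_i}D$. The sparsity constant is $\Delta:=\frac1n\max_{v}|\{i:v\in S_i\}|\in[\frac1n,1]$. KROMAGNON (asynchronous parallel sparse SVRG; step size $\gamma$, epoch size $m$, a positive integer). Start from a deterministic $\tilde x_0=x_0$. Epoch $k=0,1,2,\dots$ consists of the iterations labeled $km\le t\le(k+1)m-1$. At its beginning all cores are synchronized, the full gradient $f'(\tilde x_k)$ is computed, and the shared memory vector $x$ is set to $\tilde x_k$. During the epoch, several cores repeat in parallel, without locks: read all coordinates of $x$ (possibly inconsistently, i.e. coordinates are read at different times while other cores write), giving $\hat x$; sample $i$ uniformly in $\{1,\dots,n\}$; compute $g=f_i'(\hat x)-f_i'(\tilde x_k)+D_if'(\tilde x_k)$; for each $v\in S_i$ atomically do $[x]_v\leftarrow[x]_v-\gamma[g]_v$. At the end of the epoch (all writes completed), $\tilde x_{k+1}$ is chosen uniformly at random among $\hat x_{km},\dots,\hat x_{(k+1)m-1}$.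 Each epoch uses $2m+n$ gradient computations. Labeling (''after read''): iterations are labeled $t$ in the order in which their reads are completed; $\hat x_t$, $i_t$, $g_t$ are the read vector, sampled index and computed direction of iteration $t$. $i_t$ is uniform on $\{1,\dots,n\}$ and independent of everything in the past of the completed read $t$ (all $\hat x_u$, $u\le t$, all $i_u$, $u<t$, and the $\tilde x_j$ chosen so far). Bounded overlap assumption with constant $\tau\ge0$ (integer): an iteration is being processed from the start of its read to the end of its writes, and iterations $r$ and $t$ are never processed concurrently when $r\ge t+\tau+1$. Hence, with virtual iterates defined within epoch $k$ by $x_{km}:=\tilde x_k$ and $x_{t+1}:=x_t-\gamma g_t$, one has $\hat x_t-x_t=\gamma\sum_{u=\max(km,\,t-\tau)}^{t-1}G_u^tg_u$ for $km\le t\le(k+1)m-1$, where $G_u^t$ are (random) diagonal matrices with entries in $\{0,1\}$. *)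

(* Defs.v *)
From HB Require Import structures.
From mathcomp Require Export all_boot all_order all_algebra.
From mathcomp Require Export all_classical all_reals all_analysis.

Set Implicit Arguments.
Unset Strict Implicit.
Unset Printing Implicit Defensive.

Export Order.TTheory GRing.Theory Num.Theory.
Export numFieldNormedType.Exports.

Local Open Scope classical_set_scope.
Local Open Scope ring_scope.

Section Functions.
Variables (R : realType) (d : nat).
Implicit Types (f : 'rV[R]_d -> R) (x y : 'rV[R]_d).

(* The library norm on 'rV[R]_d is the sup norm, hence a separate Euclidean
   norm. *)
Definition enorm x : R := Num.sqrt (\sum_(v < d) x ord0 v ^+ 2).

Definition grad f x : 'rV[R]_d :=
  \row_(v < d) 'D_(delta_mx ord0 v : 'rV[R]_d) f x.

Definition lipschitz_grad (L : R) f :=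
  forall x y, enorm (grad f x - grad f y) <= L * enorm (x - y).

Definition strongly_convex (mu : R) f :=
  convex_function setT (fun x => f x - mu / 2 * enorm x ^+ 2).

End Functions.

Section FiniteSum.
Variables (R : realType) (d n : nat) (f : 'I_n -> 'rV[R]_d -> R).

Definition avg (x : 'rV[R]_d) : R := n%:R^-1 * \sum_(i < n) f i x.

Definition gsupp (i : 'I_n) : {set 'I_d} :=
  [set v | `[< exists x, grad (f i) x ord0 v != 0 >]].

Definition degree (v : 'I_d) : nat := #|[set i | v \in gsupp i]|.

Definition prob_coord (v : 'I_d) : R := (degree v)%:R / n%:R.

Definition sparsity : R := (\max_(v < d) degree v)%N%:R / n%:R.

(* [D_i y], i.e. [P_{S_i} D y] with D = diag (1 / p_v). *)
Definition reweight (i : 'I_n) (y : 'rV[R]_d) : 'rV[R]_d :=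
  \row_(v < d) (if v \in gsupp i then (prob_coord v)^-1 * y ord0 v else 0).

Definition svrg_dir (i : 'I_n) (xh xt : 'rV[R]_d) : 'rV[R]_d :=
  grad (f i) xh - grad (f i) xt + reweight i (grad avg xt).

End FiniteSum.

Definition astar (R : realType) (Delta kappa : R) (tau : nat) : R :=
  (4 * (1 + 2 * Num.sqrt Delta * tau%:R) * (1 + tau%:R / (16 * kappa)))^-1.

Section Probability.
Variables (R : realType) (disp : measure_display) (T : measurableType disp).
Variables (P : probability T R) (I : finType).

Definition uniform_on (Y : T -> I) :=
  forall j, P (Y @^-1` [set j]) = (#|I|%:R^-1)%:E.

(* Independence of [Y] and the sigma-algebra generated by [G]. *)
Definition indep_of (Y : T -> I) (G : set (set T)) :=
  forall j A, <<s G >> A ->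
    P (Y @^-1` [set j] `&` A) = (P (Y @^-1` [set j]) * P A)%E.

End Probability.

(* A run of the asynchronous algorithm. Iterations are numbered by t : nat
   through all epochs, iteration t belonging to epoch t %/ m. The physical
   instants of its elementary memory operations are arbitrary functions of the
   outcome; no bound is put on the number of cores. *)
Record run (R : realType) (d n m : nat) (T : Type) := Run {
  xhat : nat -> T -> 'rV[R]_d;
  idx : nat -> T -> 'I_n;
  pick : nat -> T -> 'I_m;            (* position, in its epoch, of the iterate
                                         selected at the end of epoch k *)
  read_start : nat -> T -> R;
  read_at : nat -> 'I_d -> T -> R;    (* when coordinate v is read *)
  read_end : nat -> T -> R;
  write_at : nat -> 'I_d -> T -> R;   (* when coordinate v is atomically updated;
                                         relevant only for v in the support *)
  write_end : nat -> T -> R }.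

Section Kromagnon.
Variables (R : realType) (d n : nat) (f : 'I_n -> 'rV[R]_d -> R).
Variables (gamma : R) (m : nat) (x0 : 'rV[R]_d).

Section Dynamics.
Variables (T : Type) (X : run R d n m T).

Definition xtilde (k : nat) (w : T) : 'rV[R]_d :=
  if k is j.+1 then xhat X (j * m + pick X j w) w else x0.

Definition dir (t : nat) (w : T) : 'rV[R]_d :=
  svrg_dir f (idx X t w) (xhat X t w) (xtilde (t %/ m) w).

(* Coordinate v of the shared vector at instant s of epoch k: its initial value
   [xtilde k] plus all the atomic updates performed before s. *)
Definition shared (k : nat) (v : 'I_d) (s : R) (w : T) : R :=
  xtilde k w ord0 v -
  \sum_(k * m <= u < k.+1 * m |
          (v \in gsupp f (idx X u w)) && (write_at X u v w < s))
     gamma * dir u w ord0 v.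

Definition processed_at (t : nat) (s : R) (w : T) :=
  read_start X t w <= s <= write_end X t w.

Definition bounded_overlap (tau : nat) :=
  forall w t r, (t + tau + 1 <= r)%N ->
    ~ exists s, processed_at t s w /\ processed_at r s w.

(* Events generated by [xhat u] for u < a, [idx u] for u < b, [xtilde k] for
   k < c. *)
Definition history (a b c : nat) : set (set T) :=
  [set A | exists u v (B : set R), [/\ (u < a)%N, measurable B &
     A = (fun w => xhat X u w ord0 v) @^-1` B]] `|`
  [set A | exists u j, (u < b)%N /\ A = idx X u @^-1` [set j]] `|`
  [set A | exists k v (B : set R), [/\ (k < c)%N, measurable B &
     A = (fun w => xtilde k w ord0 v) @^-1` B]].

Record schedule_ok : Prop := {
  read_within : forall w t v,
    read_start X t w <= read_at X t v w <= read_end X t w;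
  write_within : forall w t v, v \in gsupp f (idx X t w) ->
    read_end X t w <= write_at X t v w <= write_end X t w;
  iteration_order : forall w t,
    read_start X t w <= read_end X t w <= write_end X t w;
  after_read_labels : forall w u t, (u <= t)%N ->
    read_end X u w <= read_end X t w;
  epochs_synchronized : forall w u t, (u %/ m < t %/ m)%N ->
    write_end X u w <= read_start X t w }.

End Dynamics.

Record kromagnon (disp : measure_display) (T : measurableType disp)
    (P : probability T R) (X : run R d n m T) : Prop := {
  xhat_measurable : forall t v, measurable_fun setT (fun w => xhat X t w ord0 v);
  idx_measurable : forall t j, measurable (idx X t @^-1` [set j]);
  pick_measurable : forall k j, measurable (pick X k @^-1` [set j]);
  kromagnon_schedule : schedule_ok X;
  xhat_read : forall t w v,
    xhat X t w ord0 v = shared X (t %/ m) v (read_at X t v w) w;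
  idx_uniform : forall t, uniform_on P (idx X t);
  idx_indep : forall t,
    indep_of P (idx X t) (history X t.+1 t (t %/ m).+1);
  pick_uniform : forall k, uniform_on P (pick X k);
  pick_indep : forall k,
    indep_of P (pick X k) (history X (k.+1 * m) (k.+1 * m) k.+1) }.

End Kromagnon.

(* Main.v *)
Require Import Defs.
From mathcomp Require Import ring lra zify.

Set Implicit Arguments.
Unset Strict Implicit.
Unset Printing Implicit Defensive.

Local Open Scope classical_set_scope.
Local Open Scope ring_scope.

(** Within an epoch let [y_0 = xtilde] and [y_(j+1) = y_j - gamma g_j] be the
    virtual iterates. Expanding [|y_(j+1) - xstar|^2], convexity handles the
    inner product of [g_j] with [xhat_j - xstar]; the remaining one, with
    [xhat_j - y_j], only involves the at most [tau] updates [g_u] that overlap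
    with [j]. Since [g_j] lives on the support of [i_j], which is independent
    of [g_u], AM-GM bounds it by
    [gamma * sqrt Delta / 2 * (E|g_u|^2 + E|g_j|^2)] for each such [u].
    Summing over the epoch, with [E|g_j|^2 <= 4 L (e_j + e_tilde)] and the
    strong convexity bound on [|xtilde - xstar|^2], the suboptimality is at
    least halved. The number of steps of an epoch is [O(max(n, kappa))] under
    the conditions on [tau], and [rho = 1 / (2 (2 m + n))] works by
    Bernoulli's inequality.

    No integrability question arises: the order of the reads and writes leaves
    finitely many possible outcomes for each [xhat_t], so that all random
    vectors have finite range. *)

(** * Convex smooth functions *)

Section Dot.
Variables (R : realType) (d : nat).
Implicit Types (x y z : 'rV[R]_d) (a : R).

Definition dot x y : R := \sum_(v < d) x ord0 v * y ord0 v.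

Lemma dotC x y : dot x y = dot y x.
Proof. by apply: eq_bigr => v _; rewrite mulrC. Qed.

Lemma dotDl x y z : dot (x + y) z = dot x z + dot y z.
Proof. by rewrite -big_split; apply: eq_bigr => v _; rewrite mxE mulrDl. Qed.

Lemma dotZl a x z : dot (a *: x) z = a * dot x z.
Proof. by rewrite mulr_sumr; apply: eq_bigr => v _; rewrite mxE mulrA. Qed.

Lemma dot0l z : dot 0 z = 0.
Proof. by rewrite -(scale0r 0) dotZl mul0r. Qed.

Lemma dotNl x z : dot (- x) z = - dot x z.
Proof. by rewrite -scaleN1r dotZl mulN1r. Qed.

Lemma dotBl x y z : dot (x - y) z = dot x z - dot y z.
Proof. by rewrite dotDl dotNl. Qed.

Lemma dotDr x y z : dot x (y + z) = dot x y + dot x z.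
Proof. by rewrite !(dotC x) dotDl. Qed.

Lemma dotZr a x z : dot x (a *: z) = a * dot x z.
Proof. by rewrite !(dotC x) dotZl. Qed.

Lemma dotBr x y z : dot x (y - z) = dot x y - dot x z.
Proof. by rewrite !(dotC x) dotBl. Qed.

Lemma dot_suml (I : Type) (s : seq I) (F : I -> 'rV[R]_d) z :
  dot (\sum_(i <- s) F i) z = \sum_(i <- s) dot (F i) z.
Proof.
by elim/big_rec2: _ => [|i _ x _ <-]; rewrite ?dot0l ?dotDl.
Qed.

Lemma dot_ge0 x : 0 <= dot x x.
Proof. by apply: sumr_ge0 => v _; rewrite -expr2 sqr_ge0. Qed.

Lemma dot_eq0 x : dot x x = 0 -> x = 0.
Proof.
move=> /eqP; rewrite psumr_eq0 => [/allP x0|v _]; last by rewrite -expr2 sqr_ge0.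
apply/rowP => v; apply/eqP; rewrite mxE.
by have := x0 v (mem_index_enum v); rewrite mulf_eq0 orbb.
Qed.

Lemma sqr_enorm x : enorm x ^+ 2 = dot x x.
Proof.
rewrite sqr_sqrtr; first by apply: eq_bigr => v _; rewrite expr2.
by apply: sumr_ge0 => v _; rewrite sqr_ge0.
Qed.

Lemma enorm_ge0 x : 0 <= enorm x.
Proof. exact: sqrtr_ge0. Qed.

Lemma enormZ a x : enorm (a *: x) = `|a| * enorm x.
Proof.
apply/eqP; rewrite -(@eqrXn2 _ 2) ?mulr_ge0 ?enorm_ge0//.
by rewrite exprMn !sqr_enorm dotZl dotZr mulrA real_normK ?num_real// expr2.
Qed.

(** Cauchy-Schwarz: the squared length of [dot y y *: x - dot x y *: y] is nonnegative and equals
    [dot y y] times the gap between the squared sides. *)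
Lemma dot_le_enorm x y : dot x y <= enorm x * enorm y.
Proof.
have [y0|y0] := eqVneq (dot y y) 0.
  by rewrite (dot_eq0 y0) dotC dot0l mulr_ge0 ?enorm_ge0.
have yy : 0 < dot y y by rewrite lt_neqAle eq_sym y0 dot_ge0.
have CS : dot x y ^+ 2 <= dot x x * dot y y.
  have := dot_ge0 (dot y y *: x - dot x y *: y).
  rewrite !dotBl !dotBr !dotZl !dotZr (dotC y x) => H.
  rewrite -subr_ge0 -(pmulr_rge0 _ yy).
  by apply: le_trans H _; rewrite le_eqVlt; apply/orP; left; apply/eqP; ring.
apply: le_trans (ler_norm _) _.
rewrite -(@ler_pXn2r _ 2) ?nnegrE ?mulr_ge0 ?enorm_ge0//.
by rewrite real_normK ?num_real// exprMn !sqr_enorm.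
Qed.

End Dot.

Lemma convex_functionE (R : realType) (d : nat) (f : 'rV[R]_d -> R) (s : R)
    (x y : 'rV[R]_d) : convex_function setT f ->
  0 <= s <= 1 -> f (s *: x + (1 - s) *: y) <= s * f x + (1 - s) * f y.
Proof.
move=> cvx /andP[s0 s1].
exact: (cvx (Itv01 s0 s1) x y (in_setT _) (in_setT _)).
Qed.

(** * Tangent, descent and cocoercivity inequalities *)

Section Gradient.
Variables (R : realType) (d : nat) (f : 'rV[R]_d -> R).
Hypothesis df : forall x, differentiable f x.
Implicit Types x y v : 'rV[R]_d.

Lemma derive_grad x v : 'D_v f x = dot (grad f x) v.
Proof.
rewrite deriveE// {1}(row_sum_delta v) linear_sum; apply: eq_bigr => j _.
by rewrite linearZ/= mxE -deriveE// mulrC.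
Qed.

Lemma is_derive_line x v (s : R) :
  is_derive s 1 (fun s : R => f (x + s *: v)) (dot (grad f (x + s *: v)) v).
Proof.
have E : (fun h : R => h^-1 *:
    (((fun s : R => f (x + s *: v)) \o shift s) (h *: (1 : R))
      - f (x + s *: v))) =
         (fun h : R => h^-1 *: ((f \o shift (x + s *: v)) (h *: v) - f (x + s *: v))).
  apply/funext => h /=; congr (_ *: (f _ - _)).
  by rewrite [h *: 1]mulr1 scalerDl addrCA addrA addrC addrA.
split; first by rewrite /derivable E; exact: diff_derivable.
by rewrite /derive E; exact: derive_grad.
Qed.

(** By convexity the difference quotient along [y - x] is at most [f y - f x] for every step in
    [(0, 1]]; the directional derivative is its limit from the right. *)
Lemma convex_ge_tangent x y : convex_function setT f ->
  f x + dot (grad f x) (y - x) <= f y.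
Proof.
move=> cvx; rewrite -lerBrDl -derive_grad.
have dv : derivable f x (y - x) by exact: diff_derivable.
apply: (cvgr_to_le (cvg_dnbhs_at_right dv)).
near=> h.
have h0 : 0 < h by near: h; exact: nbhs_right_gt.
have h1 : h <= 1 by apply: ltW; near: h; exact: nbhs_right_lt.
rewrite [_ *: _]mulrC ler_pdivrMr//=.
have := convex_functionE y x cvx (introT andP (conj (ltW h0) h1)).
rewrite (_ : h *: y + _ = h *: (y - x) + x); last first.
  by rewrite scalerBr scalerBl scale1r addrA addrAC.
by move=> H; lra.
Unshelve. all: by end_near. Qed.

(** The derivative along [- grad f x] is nonnegative at a minimizer, yet it equals minus the squared
    length of the gradient. *)
Lemma grad_at_min x : (forall y, f x <= f y) -> grad f x = 0.
Proof.
move=> xmin; apply: dot_eq0; apply/eqP; rewrite eq_le dot_ge0 andbT.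
pose v := - grad f x.
have dv : derivable f x v by exact: diff_derivable.
suff : 0 <= dot (grad f x) v by rewrite dotC dotNl oppr_ge0.
rewrite -derive_grad.
apply: (cvgr_to_ge (cvg_dnbhs_at_right dv)).
near=> h.
have h0 : 0 < h by near: h; exact: nbhs_right_gt.
by rewrite /= [_ *: _]mulrC divr_ge0 ?subr_ge0 ?(ltW h0).
Unshelve. all: by end_near. Qed.

Lemma lipschitz_grad_le_quadratic (L : R) x y : lipschitz_grad L f ->
  f y <= f x + dot (grad f x) (y - x) + L / 2 * dot (y - x) (y - x).
Proof.
move=> lip; set v := y - x; set g := dot (grad f x) v.
(* [psi] is [f] on the segment minus the linear and quadratic terms of the bound, so the claim reads
   [psi 1 <= psi 0]. The mean value theorem reduces it to [dpsi c <= 0], which is Cauchy-Schwarz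
   plus the Lipschitz condition. *)
pose psi (s : R) := f (x + s *: v) - (s * g + s ^+ 2 * (L / 2 * dot v v)).
pose dpsi (s : R) := dot (grad f (x + s *: v)) v - (g + s * (L * dot v v)).
have D (s : R) : is_derive s (1 : R) psi (dpsi s).
  have Dl := is_derive_line x v s.
  pose p : {poly R} := g *: 'X + (L / 2 * dot v v) *: 'X^2.
  have -> : psi = (fun s : R => f (x + s *: v)) - horner p.
    apply/funext => t; rewrite !fctE /psi /p.
    by rewrite hornerD !hornerZ hornerX hornerXn; ring.
  have Dp := is_derive_poly p s.
  apply: is_derive_eq; rewrite /dpsi; congr (_ - _).
  rewrite /p derivD !derivZ derivX derivXn.
  by rewrite hornerD !hornerZ hornerC hornerMn hornerXn /=; field.
have psi_cont : {within `[0 : R, 1], continuous psi}.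
  by apply: derivable_within_continuous => s _; case: (D s).
have [c] := MVT ltr01 (fun s _ => D s) psi_cont.
rewrite in_itv/= => /andP[c0 c1].
rewrite subr0 mulr1 /psi scale0r addr0 scale1r {1}/v (addrC x) subrK => E.
suff : dpsi c <= 0 by rewrite -E => H; lra.
rewrite /dpsi.
suff : dot (grad f (x + c *: v) - grad f x) v <= c * (L * dot v v).
  by rewrite dotBl -/g => H; lra.
apply: le_trans (dot_le_enorm _ _) _.
apply: le_trans (ler_wpM2r (enorm_ge0 _) (lip _ _)) _.
rewrite addrAC subrr add0r enormZ (ger0_norm (ltW c0)).
by rewrite -sqr_enorm expr2 le_eqVlt; apply/orP; left; apply/eqP; ring.
Qed.

(** The quadratic bound from [x] and the tangent at [y] enclose [f z]. The point [z] minimizes the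
    quadratic upper bound, taken at [x], of [f] minus its linear part at [y], whence the constant
    [2 * L]. *)
Lemma grad_cocoercive (L : R) x y : 0 < L ->
  convex_function setT f -> lipschitz_grad L f ->
  dot (grad f x - grad f y) (grad f x - grad f y) <=
  2 * L * (f x - f y - dot (grad f y) (x - y)).
Proof.
move=> L0 cvx lip; set u := grad f x - grad f y.
set z := x - L^-1 *: u.
have := convex_ge_tangent y z cvx.
have := lipschitz_grad_le_quadratic x z lip.
have -> : z - x = - (L^-1 *: u) by rewrite /z addrAC subrr add0r.
have -> : z - y = (x - y) - L^-1 *: u by rewrite /z addrAC.
rewrite -!scaleNr (dotDr _ (x - y)) !dotZr !dotZl.
have -> : dot u u = dot (grad f x) u - dot (grad f y) u by rewrite {1}/u dotBl.
move: (dot (grad f x) u) (dot (grad f y) u) => a b H1 H2.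
have H : L^-1 * (a - b) <= 2 * (f x - f y - dot (grad f y) (x - y)).
  have LV : L / 2 * (- L^-1 * (- L^-1 * (a - b))) = L^-1 * (a - b) / 2.
    by field; rewrite gt_eqF.
  by rewrite LV in H1; move: (L^-1) H1 H2 => i H1 H2; nra.
by rewrite (mulrC 2 L) -mulrA -ler_pdivrMl.
Qed.

(** Strong convexity at [s *: y + (1 - s) *: x], where [f] is at least [f x], gives after division
    by [s] the bound weakened by a factor [1 - s]; [s] then has to be small. *)
Lemma strongly_convex_min (mu : R) x y : strongly_convex mu f ->
  (forall z, f x <= f z) -> mu / 2 * dot (y - x) (y - x) <= f y - f x.
Proof.
move=> sc xmin; set Q := dot _ _.
have H (s : R) : 0 < s -> s < 1 -> (1 - s) * (mu / 2 * Q) <= f y - f x.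
  move=> s0 s1.
  have := convex_functionE y x sc (introT andP (conj (ltW s0) (ltW s1))).
  have := xmin (s *: y + (1 - s) *: x).
  rewrite !sqr_enorm !dotDl !dotDr !dotZl !dotZr (dotC x y) => H1 H2.
  have QE : Q = dot y y - 2 * dot y x + dot x x.
    by rewrite /Q !dotBl !dotBr (dotC x y); ring.
  by rewrite -(ler_pM2l s0) QE; nra.
have fxy := xmin y.
rewrite leNgt; apply/negP; set c := mu / 2 * Q in H * => cB.
have c0 : 0 < c by lra.
(* This replaces a limit: if the bound failed, [(1 - s) * c] would be the midpoint of [c] and
   [f y - f x], hence above [f y - f x], against [H]. *)
pose s := (c - (f y - f x)) / (2 * c).
have sc' : s * c = (c - (f y - f x)) / 2 by rewrite /s; field; rewrite gt_eqF.
have s0 : 0 < s by rewrite divr_gt0; lra.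
have s1 : s < 1 by rewrite ltr_pdivrMr; lra.
by have := H s s0 s1; rewrite mulrBl sc'; lra.
Qed.

End Gradient.

(** * Averages over the sampled index *)

Lemma row_subE (R : realType) (d : nat) (x y : 'rV[R]_d) v :
  (x - y) ord0 v = x ord0 v - y ord0 v.
Proof. by rewrite !mxE. Qed.

Section Average.
Variables (R : realType) (d n : nat) (f : 'I_n -> 'rV[R]_d -> R).
Hypothesis n0 : (0 < n)%N.
Hypothesis df : forall i x, differentiable (f i) x.
Implicit Types x y z : 'rV[R]_d.

Lemma avgE : avg f = n%:R^-1 *: (\sum_(i < n) f i).
Proof. by apply/funext => x; rewrite /avg fctE fct_sumE. Qed.

Lemma differentiable_avg x : differentiable (avg f) x.
Proof. by rewrite avgE; apply/differentiableZ/differentiable_sum. Qed.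

Lemma grad_avg x : grad (avg f) x = n%:R^-1 *: \sum_(i < n) grad (f i) x.
Proof.
apply/rowP => v; rewrite !mxE summxE avgE.
have dfv i : derivable (f i) x (delta_mx ord0 v) by exact: diff_derivable.
rewrite deriveZ; last exact: derivable_sum.
by rewrite derive_sum//; congr (_ * _); apply: eq_bigr => i _; rewrite mxE.
Qed.

Lemma grad_avg_coord x v :
  grad (avg f) x ord0 v = n%:R^-1 * \sum_(i < n) grad (f i) x ord0 v.
Proof. by rewrite grad_avg mxE summxE. Qed.

Lemma dot_grad_avg x z :
  dot (grad (avg f) x) z = n%:R^-1 * \sum_(i < n) dot (grad (f i) x) z.
Proof. by rewrite grad_avg dotZl dot_suml. Qed.

Lemma ler_mean (F G : 'I_n -> R) : (forall i, F i <= G i) ->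
  n%:R^-1 * \sum_(i < n) F i <= n%:R^-1 * \sum_(i < n) G i.
Proof. by move=> FG; rewrite ler_wpM2l ?invr_ge0 ?ler0n// ler_sum. Qed.

Lemma mean_cst (c : R) : n%:R^-1 * \sum_(i < n) c = c.
Proof.
by rewrite sumr_const card_ord -[c *+ n]mulr_natl mulKf// pnatr_eq0 -lt0n.
Qed.

Lemma mean_lin (a b : R) (F G : 'I_n -> R) :
  n%:R^-1 * \sum_(i < n) (a * F i + b * G i) =
  a * (n%:R^-1 * \sum_(i < n) F i) + b * (n%:R^-1 * \sum_(i < n) G i).
Proof. by rewrite big_split/= -!mulr_sumr; ring. Qed.

Lemma avg_ge_tangent x y : (forall i, convex_function setT (f i)) ->
  avg f x + dot (grad (avg f) x) (y - x) <= avg f y.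
Proof.
move=> cvx; rewrite /avg dot_grad_avg -mulrDr -big_split/=.
by apply: ler_mean => i; exact: convex_ge_tangent.
Qed.

Lemma avg_le_quadratic (L : R) x y : (forall i, lipschitz_grad L (f i)) ->
  avg f y <= avg f x + dot (grad (avg f) x) (y - x) +
             L / 2 * dot (y - x) (y - x).
Proof.
move=> lip; rewrite -[X in _ <= _ + X]mean_cst dot_grad_avg /avg.
rewrite -!mulrDr -!big_split/=.
by apply: ler_mean => i; exact: lipschitz_grad_le_quadratic.
Qed.

(** At distance one from the minimizer, the suboptimality is at least [mu / 2] by strong convexity
    and at most [L / 2] by smoothness. *)
Lemma strong_convexity_le_lipschitz (L mu : R) x : (0 < d)%N ->
  (forall i, lipschitz_grad L (f i)) -> strongly_convex mu (avg f) ->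
  (forall y, avg f x <= avg f y) -> mu <= L.
Proof.
move=> d0 lip sc xmin; pose e : 'rV[R]_d := delta_mx ord0 (Ordinal d0).
have := strongly_convex_min (x + e) sc xmin.
have := avg_le_quadratic x (x + e) lip.
rewrite (grad_at_min differentiable_avg xmin) dot0l addr0.
rewrite [x + e]addrC addrK.
have -> : dot e e = 1.
  rewrite /dot (bigD1 (Ordinal d0))//= mxE !eqxx mulr1 big1 ?addr0// => i.
  by rewrite mxE => /negPf ->; rewrite andbF mul0r.
by move=> H1 H2; lra.
Qed.

Lemma grad_notin_gsupp i x v : v \notin gsupp f i -> grad (f i) x ord0 v = 0.
Proof.
by rewrite inE => /asboolP H; apply/eqP; apply: contrapT => /negP ?; apply: H; exists x.
Qed.

Lemma svrg_dirE i x y v : svrg_dir f i x y ord0 v =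
  grad (f i) x ord0 v - grad (f i) y ord0 v +
  (if v \in gsupp f i then (prob_coord f v)^-1 * grad (avg f) y ord0 v else 0).
Proof.
rewrite /svrg_dir /reweight.
by move: (grad (f i) x) (grad (f i) y) (grad (avg f) y) => ? ? ?; rewrite !mxE.
Qed.

Lemma svrg_dir_notin_gsupp i x y v :
  v \notin gsupp f i -> svrg_dir f i x y ord0 v = 0.
Proof.
by move=> iv; rewrite svrg_dirE (negPf iv) addr0 !grad_notin_gsupp// subrr.
Qed.

Lemma prob_coordE v : prob_coord f v = n%:R^-1 * \sum_(i < n) (v \in gsupp f i)%:R.
Proof.
rewrite /prob_coord mulrC /degree -sum1_card natr_sum big_mkcond/=.
congr (_ * _); apply: eq_bigr => i _.
have -> : (i \in [set i | v \in gsupp f i]) = (v \in gsupp f i).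
  by apply/idP/idP; rewrite classical_sets.in_setE.
by case: ifP.
Qed.

Lemma prob_coord_ge0 v : 0 <= prob_coord f v.
Proof. by rewrite divr_ge0 ?ler0n. Qed.

Lemma prob_coord_gt0 i v : v \in gsupp f i -> 0 < prob_coord f v.
Proof.
move=> iv; rewrite divr_gt0 ?ltr0n//; apply/card_gt0P; exists i.
by rewrite classical_sets.in_setE.
Qed.

Lemma prob_coord_le_sparsity v : prob_coord f v <= sparsity f.
Proof.
by rewrite ler_wpM2r ?invr_ge0 ?ler0n// ler_nat leq_bigmax.
Qed.

(** If it were 0, all supports would be empty and all gradients zero, hence Lipschitz with constant
    0, which forces [mu <= 0]. *)
Lemma sparsity_gt0 (mu : R) x : (0 < d)%N -> 0 < mu ->
  strongly_convex mu (avg f) -> (forall y, avg f x <= avg f y) ->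
  0 < sparsity f.
Proof.
move=> d0 mu0 sc xmin; rewrite lt_neqAle eq_sym divr_ge0 ?ler0n// andbT.
apply/negP => /eqP s0; move: mu0; apply/negP; rewrite -leNgt.
apply: (strong_convexity_le_lipschitz d0 _ sc xmin) => i y z.
have gE u : grad (f i) u = 0.
  apply/rowP => v; rewrite [RHS]mxE.
  apply: grad_notin_gsupp; apply/negP => iv.
  have := prob_coord_le_sparsity v; rewrite s0 leNgt => /negP; apply.
  exact: prob_coord_gt0 iv.
by rewrite !gE subrr mul0r -(scale0r (0 : 'rV[R]_d)) enormZ normr0 mul0r.
Qed.

Lemma mean_gsupp (c : R) v :
  n%:R^-1 * \sum_(i < n) (if v \in gsupp f i then c else 0) = prob_coord f v * c.
Proof.
rewrite prob_coordE -mulrA mulr_suml; congr (_ * _); apply: eq_bigr => i _.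
by case: ifP; rewrite ?mul1r ?mul0r.
Qed.

(** A random support contains coordinate [v] with frequency [p_v], at most Delta. This is the gain
    from sparsity for overlapping updates. *)
Lemma mean_gsupp_sqr_le z :
  n%:R^-1 * \sum_(i < n) \sum_(v < d | v \in gsupp f i) z ord0 v ^+ 2 <=
  sparsity f * dot z z.
Proof.
under eq_bigr do rewrite big_mkcond/=.
rewrite exchange_big mulr_sumr [leRHS]mulr_sumr; apply: ler_sum => v _.
rewrite mean_gsupp -expr2 ler_wpM2r ?sqr_ge0//.
exact: prob_coord_le_sparsity.
Qed.

Lemma grad_avg_prob0 x v : prob_coord f v = 0 -> grad (avg f) x ord0 v = 0.
Proof.
move=> p0; rewrite grad_avg_coord big1 ?mulr0// => i _.
apply: grad_notin_gsupp; apply/negP => iv; have := prob_coord_gt0 iv.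
by rewrite p0 ltxx.
Qed.

(** Unbiasedness: averaging over [i] cancels the factor [1 / p_v] of the reweighting, so the two
    terms in [y] compensate. *)
Lemma mean_svrg_dir x y z :
  n%:R^-1 * \sum_(i < n) dot z (svrg_dir f i x y) = dot z (grad (avg f) x).
Proof.
rewrite exchange_big mulr_sumr; apply: eq_bigr => v _ /=.
rewrite -mulr_sumr mulrCA; congr (_ * _).
under eq_bigr do rewrite svrg_dirE.
rewrite big_split/= sumrB mulrDr mulrBr mean_gsupp -!grad_avg_coord.
(* On a coordinate outside every support the factors [p_v] and [1 / p_v] do not cancel, but the full
   gradient vanishes there. *)
have [p0|p0] := eqVneq (prob_coord f v) 0.
  by rewrite (grad_avg_prob0 y p0) subr0 !mulr0 addr0.
by rewrite mulVKf// subrK.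
Qed.

(** In the average of the cocoercivity bounds based at [xs], the linear terms add up to a product
    with the full gradient at [xs], which is zero. *)
Lemma mean_cocoercive (L : R) x xs : 0 < L ->
  (forall i, convex_function setT (f i)) -> (forall i, lipschitz_grad L (f i)) ->
  grad (avg f) xs = 0 ->
  n%:R^-1 * \sum_(i < n) dot (grad (f i) x - grad (f i) xs)
                             (grad (f i) x - grad (f i) xs) <=
  2 * L * (avg f x - avg f xs).
Proof.
move=> L0 cvx lip gxs.
have H i := grad_cocoercive (df i) x xs L0 (cvx i) (lip i).
apply: le_trans (ler_mean H) _.
rewrite -mulr_sumr mulrCA; apply: ler_wpM2l; first by rewrite mulr_ge0 ?ltW.
rewrite !sumrB !mulrBr -dot_grad_avg gxs dot0l subr0.
exact: lexx.
Qed.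

Lemma mean_dot (F G : 'I_n -> 'rV[R]_d) :
  n%:R^-1 * \sum_(i < n) dot (F i) (G i) =
  \sum_(v < d) (n%:R^-1 * \sum_(i < n) F i ord0 v * G i ord0 v).
Proof. by rewrite exchange_big mulr_sumr. Qed.

(* With [z_i] the gradient difference and [G] the full gradient, the mean of
   [dot z_i (D_i G)] equals that of [|D_i G|^2], so subtracting [D_i G] lowers the
   second moment by exactly that amount. *)
Lemma mean_control_variate x xs : grad (avg f) xs = 0 ->
  n%:R^-1 * \sum_(i < n)
    dot (grad (f i) x - grad (f i) xs - reweight f i (grad (avg f) x))
        (grad (f i) x - grad (f i) xs - reweight f i (grad (avg f) x)) <=
  n%:R^-1 * \sum_(i < n) dot (grad (f i) x - grad (f i) xs)
                             (grad (f i) x - grad (f i) xs).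
Proof.
move=> gxs; rewrite !mean_dot; apply: ler_sum => v _ /=.
set p := prob_coord f v; set G := grad (avg f) x ord0 v.
pose z i := grad (f i) x ord0 v - grad (f i) xs ord0 v.
have zE i : (grad (f i) x - grad (f i) xs) ord0 v = z i by rewrite row_subE.
have z0 i : v \notin gsupp f i -> z i = 0.
  by move=> iv; rewrite /z !grad_notin_gsupp// subrr.
have zG : n%:R^-1 * \sum_(i < n) z i = G.
  rewrite sumrB mulrBr -!grad_avg_coord gxs -[RHS]subr0; congr (_ - _).
  by rewrite mxE.
have -> : n%:R^-1 * \sum_(i < n) (grad (f i) x - grad (f i) xs -
    reweight f i (grad (avg f) x)) ord0 v * (grad (f i) x - grad (f i) xs -
    reweight f i (grad (avg f) x)) ord0 v =
  n%:R^-1 * (\sum_(i < n) z i * z i + (- 2 * p^-1 * G) * (\sum_(i < n) z i) +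
     \sum_(i < n) (if v \in gsupp f i then (p^-1 * G) ^+ 2 else 0)).
  congr (_ * _); rewrite mulr_sumr -!big_split/=; apply: eq_bigr => i _.
  rewrite row_subE zE [reweight _ _ _ _ _]mxE -/p -/G.
  by case: ifPn => iv; [ring | rewrite (z0 _ iv); ring].
rewrite !mulrDr mean_gsupp -/p [n%:R^-1 * (_ * \sum_(i < n) z i)]mulrCA zG.
under [X in _ <= n%:R^-1 * X]eq_bigr do rewrite zE.
rewrite -addrA gerDl.
have -> : - 2 * p^-1 * G * G + p * (p^-1 * G) ^+ 2 = - (p^-1 * G ^+ 2).
  have [->|p0] := eqVneq p 0; first by rewrite invr0; ring.
  by field.
by rewrite oppr_le0 mulr_ge0 ?sqr_ge0// invr_ge0 prob_coord_ge0.
Qed.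

(** The direction is split at [xs] as [a i - b i], at the cost of a factor 2. Cocoercivity bounds
    the mean square of [a], and that of [b] once the control variate is dropped. *)
Lemma mean_svrg_dir_sqr (L : R) x y xs : 0 < L ->
  (forall i, convex_function setT (f i)) -> (forall i, lipschitz_grad L (f i)) ->
  (forall z, avg f xs <= avg f z) ->
  n%:R^-1 * \sum_(i < n) dot (svrg_dir f i x y) (svrg_dir f i x y) <=
  4 * L * (avg f x - avg f xs) + 4 * L * (avg f y - avg f xs).
Proof.
move=> L0 cvx lip xmin.
have gxs := grad_at_min differentiable_avg xmin.
pose a i := grad (f i) x - grad (f i) xs.
pose b i := grad (f i) y - grad (f i) xs - reweight f i (grad (avg f) y).
have H i : dot (svrg_dir f i x y) (svrg_dir f i x y) <=
    2 * dot (a i) (a i) + 2 * dot (b i) (b i).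
  have -> : svrg_dir f i x y = a i - b i.
    rewrite /svrg_dir /a /b; move: (grad (f i) x) (grad (f i) y) (grad (f i) xs).
    by move: (reweight _ _ _) => r u1 u2 u3; apply/rowP => v; rewrite !mxE; ring.
  move: (a i) (b i) => u1 u2; have := dot_ge0 (u1 + u2).
  by rewrite !dotBl !dotBr !dotDl !dotDr => ?; lra.
apply: le_trans (ler_mean H) _; rewrite mean_lin.
have Ha := mean_cocoercive x L0 cvx lip gxs.
have Hb := mean_cocoercive y L0 cvx lip gxs.
have Hc := mean_control_variate y gxs.
rewrite /a /b; lra.
Qed.

End Average.

(** * Random elements with finite range *)

Section Simple.
Variables (T : Type) (G : set (set T)).

(** Measurability is asked of fibres only: with a finite range every preimage is a finite union of
    fibres. Composition with any function, such as a gradient, is then allowed without knowing that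
    function to be measurable. *)
Definition simple (W : Type) (Y : T -> W) :=
  finite_set (range Y) /\ forall y, <<s G >> (Y @^-1` [set y]).

Lemma gset0 : <<s G >> set0.
Proof. exact (@sigma_algebra0 T setT G). Qed.

Lemma gsetC A : <<s G >> A -> <<s G >> (~` A).
Proof. by move=> GA; rewrite -setTD; exact (@sigma_algebraCD T setT G A GA). Qed.

Lemma gsetT : <<s G >> setT.
Proof. by have := gsetC gset0; rewrite setC0. Qed.

Lemma gsetU A B : <<s G >> A -> <<s G >> B -> <<s G >> (A `|` B).
Proof.
move=> GA GB; rewrite -bigcup2E.
refine (@sigma_algebra_bigcup T setT G _ _) => -[//|[//|i]]; exact gset0.
Qed.

Lemma gsetI A B : <<s G >> A -> <<s G >> B -> <<s G >> (A `&` B).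
Proof.
move=> GA GB; rewrite -(setCK (_ `&` _)) setCI.
exact (gsetC (gsetU (gsetC GA) (gsetC GB))).
Qed.

Lemma gset_fin_bigcup (I : choiceType) (D : set I) (F : I -> set T) :
  finite_set D -> (forall i, D i -> <<s G >> (F i)) ->
  <<s G >> (\bigcup_(i in D) F i).
Proof.
move=> /finite_fsetP[X ->] GF; rewrite bigcup_fset.
rewrite big_seq; elim/big_rec: _ => [|i A iX GA]; first exact gset0.
exact (gsetU (GF i iX) GA).
Qed.

Lemma finite_range_comp (V W : Type) (phi : V -> W) (Y : T -> V) :
  finite_set (range Y) -> finite_set (range (fun w => phi (Y w))).
Proof. by move=> fY; rewrite -(image_comp Y phi); exact: finite_image. Qed.

Lemma finite_range_pair (V W : Type) (Y : T -> V) (Z : T -> W) :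
  finite_set (range Y) -> finite_set (range Z) ->
  finite_set (range (fun w => (Y w, Z w))).
Proof.
move=> fY fZ; apply: sub_finite_set (finite_setX fY fZ).
by move=> _ [w _ <-]; split; exists w.
Qed.

Lemma finite_range_sum (V : nmodType) (I : Type) (s : seq I) (F : I -> T -> V) :
  (forall i, finite_set (range (F i))) ->
  finite_set (range (fun w => \sum_(i <- s) F i w)).
Proof.
move=> fF; elim: s => [|i s IH].
  apply: sub_finite_set (finite_set1 (0 : V)).
  by move=> _ [w _ <-]; rewrite big_nil.
have := finite_range_comp (fun p => p.1 + p.2) (finite_range_pair (fF i) IH).
by apply: sub_finite_set => _ [w _ <-]; exists w => //; rewrite big_cons.
Qed.

Lemma simple_comp (V : choiceType) (W : Type) (phi : V -> W) (Y : T -> V) :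
  simple Y -> simple (fun w => phi (Y w)).
Proof.
move=> [fY GY]; split; first exact: finite_range_comp.
move=> z; rewrite (_ : _ @^-1` _ =
    \bigcup_(y in range Y `&` [set y | phi y = z]) (Y @^-1` [set y])).
  apply: gset_fin_bigcup => //; exact: finite_setIl.
apply/seteqP; split=> [w /= wz|w [_ [_ <-]] /= -> //].
by exists (Y w) => //; split => //; exists w.
Qed.

Lemma simple_pair (V W : Type) (Y : T -> V) (Z : T -> W) :
  simple Y -> simple Z -> simple (fun w => (Y w, Z w)).
Proof.
move=> [fY GY] [fZ GZ]; split; first exact: finite_range_pair.
move=> [y z]; rewrite (_ : _ @^-1` _ = Y @^-1` [set y] `&` Z @^-1` [set z]).
  exact (gsetI (GY y) (GZ z)).
by apply/seteqP; split=> [w /= [-> ->]|w /= [-> ->]].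
Qed.

Lemma simple_cst (W : Type) (c : W) : simple (fun=> c).
Proof.
split; first by apply: sub_finite_set (finite_set1 c) => _ [w _ <-].
move=> y; rewrite preimage_cst; case: ifP => _; first exact gsetT.
exact gset0.
Qed.

Lemma simple_comp2 (U V : choiceType) (W : Type) (phi : U -> V -> W)
    (Y : T -> U) (Z : T -> V) :
  simple Y -> simple Z -> simple (fun w => phi (Y w) (Z w)).
Proof.
by move=> sY sZ; apply: (simple_comp (fun p => phi p.1 p.2) (simple_pair sY sZ)).
Qed.

Lemma simple_sum (V : nmodType) (I : Type) (s : seq I) (p : pred I)
    (F : I -> T -> V) :
  (forall i, simple (F i)) -> simple (fun w => \sum_(i <- s | p i) F i w).
Proof.
move=> sF; elim: s => [|i s IH].
  by under eq_fun do rewrite big_nil; exact: simple_cst.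
under eq_fun do rewrite big_cons.
by case: (p i) => //; exact: (simple_comp2 +%R (sF i) IH).
Qed.

Lemma simple_fin (I : finType) (Y : T -> I) :
  (forall j, <<s G >> (Y @^-1` [set j])) -> simple Y.
Proof. by split. Qed.

End Simple.

Lemma simple_sub (T : Type) (G H : set (set T)) (W : Type) (Y : T -> W) :
  <<s G >> `<=` <<s H >> -> simple G Y -> simple H Y.
Proof. by move=> GH [fY GY]; split => // y; exact: GH. Qed.

(** * Expectation of variables with finite range *)

Section Expectation.
Variables (R : realType) (disp : measure_display) (T : measurableType disp).
Variable P : probability T R.
Implicit Types Y Z : T -> R.

(** Real-valued, for linear arithmetic; [fine] loses nothing on finite-range variables, whose
    expectation is finite. *)
Definition Ex (Y : T -> R) : R := fine ('E_P[Y])%E.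

Notation rv := (simple (@measurable _ T)).

Lemma measurable_sigma : <<s @measurable _ T >> = @measurable _ T.
Proof. exact/sigma_algebra_id/sigma_algebra_measurable. Qed.

Lemma simple_measurable (W : choiceType) (Y : T -> W) (B : set W) : rv Y ->
  measurable (Y @^-1` B).
Proof.
move=> sY; have [_] := simple_comp (fun y => y \in B) sY.
move=> /(_ true); rewrite measurable_sigma; congr measurable.
by apply/seteqP; split=> w /=; [exact: set_mem | exact: mem_set].
Qed.

Lemma simple_integrable Y : rv Y -> P.-integrable setT (EFin \o Y).
Proof.
move=> sY; apply: measurable_bounded_integrable => //.
- by apply: le_lt_trans (probability_le1 P measurableT) _; rewrite ltry.
- by move=> _ B mB; rewrite setTI; exact: simple_measurable.
have [/finite_seqP[X XE] _] := sY.
(* The sum of the absolute values of all possible outcomes bounds each of them. *)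
pose M := \sum_(x <- X) `|x|.
exists M; split; first exact: num_real.
move=> N MN w _; apply: le_trans (ltW MN).
have : Y w \in X.
  by have : [set` X] (Y w) by rewrite -XE; exists w.
move=> YX; rewrite /M (big_rem _ YX)/= lerDl.
by apply: sumr_ge0 => ? _; exact: normr_ge0.
Qed.

Lemma ExE Y : rv Y -> ('E_P[Y] = (Ex Y)%:E)%E.
Proof.
move=> sY; rewrite /Ex fineK// unlock; apply: integrable_fin_num => //.
exact: simple_integrable.
Qed.

Lemma eq_Ex Y Z : Y =1 Z -> Ex Y = Ex Z.
Proof. by move=> /funext ->. Qed.

Lemma ExD Y Z : rv Y -> rv Z -> Ex (fun w => Y w + Z w) = Ex Y + Ex Z.
Proof.
move=> sY sZ; apply: EFin_inj; rewrite EFinD -!ExE//; last exact: simple_comp2 sY sZ.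
by rewrite unlock integralD_EFin//; exact: simple_integrable.
Qed.

Lemma Ex_cst (c : R) : Ex (fun=> c) = c.
Proof. by rewrite /Ex expectation_cst. Qed.

Lemma ExZ (c : R) Y : rv Y -> Ex (fun w => c * Y w) = c * Ex Y.
Proof.
move=> sY; apply: EFin_inj; rewrite EFinM -!ExE//; last exact: simple_comp sY.
rewrite unlock -integralZl//; exact: simple_integrable.
Qed.

Lemma ExB Y Z : rv Y -> rv Z -> Ex (fun w => Y w - Z w) = Ex Y - Ex Z.
Proof.
move=> sY sZ; under eq_Ex do rewrite -mulN1r.
by rewrite ExD//; [rewrite ExZ// mulN1r | exact: simple_comp sZ].
Qed.

Lemma Ex_sum (I : Type) (s : seq I) (p : pred I) (F : I -> T -> R) :
  (forall i, rv (F i)) ->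
  Ex (fun w => \sum_(i <- s | p i) F i w) = \sum_(i <- s | p i) Ex (F i).
Proof.
move=> sF; elim: s => [|i s IH].
  by under eq_Ex do rewrite big_nil; rewrite Ex_cst big_nil.
under eq_Ex do rewrite big_cons; rewrite big_cons.
by case: (p i) => //; rewrite ExD ?IH//; exact: simple_sum.
Qed.

Lemma ler_Ex Y Z : rv Y -> rv Z -> (forall w, Y w <= Z w) -> Ex Y <= Ex Z.
Proof.
move=> sY sZ YZ; rewrite -lee_fin -!ExE// unlock.
apply: le_integral => //; [exact: simple_integrable..|].
by move=> w _; rewrite lee_fin.
Qed.

Lemma Ex_indic (A : set T) : measurable A -> Ex (\1_A) = fine (P A).
Proof. by move=> mA; rewrite /Ex expectation_indic. Qed.

Lemma simpleE G Y : simple G Y -> exists2 s : seq R, uniq s &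
  forall w, Y w = \sum_(y <- s) y * \1_(Y @^-1` [set y]) w.
Proof.
move=> [/finite_seqP[X XE] _]; exists (undup X); first exact: undup_uniq.
move=> w; have YX : Y w \in undup X.
  rewrite mem_undup.
  by have : [set` X] (Y w) by rewrite -XE; exists w.
rewrite (bigD1_seq (Y w)) ?undup_uniq//= indicE mem_set// mulr1 big1 ?addr0//.
by move=> y /eqP yY; rewrite indicE memNset ?mulr0// => /= /esym.
Qed.

(** * Averaging out a uniform index independent of the past *)

Section Independence.
Variables (I : finType) (J : T -> I) (G : set (set T)).
Hypothesis GT : <<s G >> `<=` @measurable _ T.
Hypothesis J_meas : forall j, measurable (J @^-1` [set j]).
Hypothesis J_unif : uniform_on P J.
Hypothesis J_indep : indep_of P J G.

Lemma simple_rv (W : Type) (Y : T -> W) : simple G Y -> rv Y.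
Proof. by apply: simple_sub; rewrite measurable_sigma. Qed.

Lemma rv_indic (A : set T) : measurable A -> rv (\1_A : T -> R).
Proof.
move=> mA; have sA : rv (fun w => w \in A).
  apply: simple_fin => -[]; rewrite measurable_sigma.
    rewrite (_ : _ @^-1` _ = A)//.
    by apply/seteqP; split=> w /=; [exact: set_mem | exact: mem_set].
  rewrite (_ : _ @^-1` _ = ~` A); first exact: measurableC.
  apply/seteqP; split=> w /=; first by move=> + /mem_set => ->.
  by move=> ?; rewrite memNset.
exact: (simple_comp (fun b : bool => b%:R) sA).
Qed.

(** [Y] is a finite combination of indicators of its fibres, and independence applies to each
    fibre. *)
Lemma Ex_indic_mul j Y : simple G Y ->
  Ex (fun w => \1_(J @^-1` [set j]) w * Y w) = #|I|%:R^-1 * Ex Y.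
Proof.
move=> sY; have [s us YE] := simpleE sY.
have mY y : measurable (Y @^-1` [set y]).
  by case: (simple_rv sY) => _; rewrite measurable_sigma.
have mI y : measurable (J @^-1` [set j] `&` Y @^-1` [set y]) by exact: measurableI.
transitivity (\sum_(y <- s) y * Ex (\1_(J @^-1` [set j] `&` Y @^-1` [set y]))).
  under [RHS]eq_bigr => y _ do rewrite -(ExZ y (rv_indic (mI y))).
  rewrite -Ex_sum => [|y]; last exact: (simple_comp ( *%R y) (rv_indic (mI y))).
  apply: eq_Ex => w; rewrite {1}YE mulr_sumr; apply: eq_bigr => y _.
  by rewrite indicI/= mulrCA.
transitivity (#|I|%:R^-1 * \sum_(y <- s) y * Ex (\1_(Y @^-1` [set y]))).
  rewrite mulr_sumr; apply: eq_bigr => y _; rewrite !Ex_indic//.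
  rewrite J_indep ?J_unif; last by case: sY.
  by rewrite fineM ?fin_num_measure// mulrCA.
congr (_ * _); under eq_bigr => y _ do rewrite -(ExZ y (rv_indic (mY y))).
rewrite -Ex_sum => [|y]; last exact: (simple_comp ( *%R y) (rv_indic (mY y))).
by apply: eq_Ex => w; rewrite [RHS]YE.
Qed.

(** Splitting over the value [j] of [J] freezes the first argument; what remains is known from [G],
    so each event [J = j] factors out. This plays the role of a conditional expectation. *)
Lemma Ex_uniform_indep (F : I -> T -> R) : (forall j, simple G (F j)) ->
  Ex (fun w => F (J w) w) = #|I|%:R^-1 * \sum_j Ex (F j).
Proof.
move=> sF; rewrite mulr_sumr.
under eq_bigr => j _ do rewrite -(Ex_indic_mul j (sF j)).
rewrite -Ex_sum => [|j]; last first.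
  by apply: (simple_comp2 *%R) (rv_indic (J_meas j)) (simple_rv (sF j)).
apply: eq_Ex => w; rewrite (bigD1 (J w))//= indicE mem_set// mul1r big1 ?addr0//.
by move=> j /eqP jJ; rewrite indicE memNset ?mul0r// => /= /esym.
Qed.

End Independence.

End Expectation.

(** * Reads and writes *)

Section Rows.
Variables (R : realType) (d : nat) (T : Type) (G : set (set T)).
Variable Y : T -> 'rV[R]_d.

Lemma finite_range_row :
  (forall v, finite_set (range (fun w => Y w ord0 v))) -> finite_set (range Y).
Proof.
move=> fY; rewrite (_ : Y = fun w => \sum_(v < d) Y w ord0 v *: delta_mx ord0 v).
  apply: finite_range_sum => v.
  exact: (finite_range_comp (fun a => a *: delta_mx ord0 v) (fY v)).
by apply/funext => w; exact: row_sum_delta.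
Qed.

Lemma simple_row : (forall v, simple G (fun w => Y w ord0 v)) -> simple G Y.
Proof.
move=> sY; rewrite (_ : Y = fun w => \sum_(v < d) Y w ord0 v *: delta_mx ord0 v).
  apply: simple_sum => v.
  exact: (simple_comp (fun a => a *: delta_mx ord0 v) (sY v)).
by apply/funext => w; exact: row_sum_delta.
Qed.

End Rows.

Section Run.
Variables (R : realType) (d n : nat) (f : 'I_n -> 'rV[R]_d -> R).
Variables (gamma : R) (m : nat) (x0 : 'rV[R]_d).
Variables (disp : measure_display) (T : measurableType disp).
Variables (P : probability T R) (X : run R d n m T).
Hypothesis HX : kromagnon f gamma x0 P X.
Hypothesis m0 : (0 < m)%N.

Notation xt := (xtilde x0 X).
Notation g := (dir f x0 X).
Notation rv := (simple (@measurable _ T)).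

Let sched := kromagnon_schedule HX.

Lemma epochE k j : (j < m)%N -> ((k * m + j) %/ m)%N = k.
Proof. by move=> jm; rewrite divnMDl// divn_small// addn0. Qed.

(** A write comes no earlier than the end of its own read, which the after-read labels place no
    earlier than the end of the read of [t]. With [u = t]: an iteration never reads its own
    writes. *)
Lemma write_not_seen w u t v : (t <= u)%N -> v \in gsupp f (idx X u w) ->
  (write_at X u v w < read_at X t v w) = false.
Proof.
move=> tu vu; apply/negbTE; rewrite -leNgt.
have /andP[_ H1] := read_within sched w t v.
have H2 := after_read_labels sched w tu.
have /andP[H3 _] := write_within sched vu.
exact: le_trans (le_trans H1 H2) H3.
Qed.

Lemma write_seen tau w u t v : bounded_overlap X tau -> (u + tau < t)%N ->
  v \in gsupp f (idx X u w) -> write_at X u v w < read_at X t v w.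
Proof.
move=> ov ut vu.
have /andP[_ H1] := write_within sched vu.
have /andP[H2 _] := read_within sched w t v.
apply: le_lt_trans H1 (lt_le_trans _ H2).
rewrite ltNge; apply/negP => tu.
apply: (ov w u t); first by rewrite addn1.
have /andP[ut1 ut2] := iteration_order sched w t.
have /andP[uu1 uu2] := iteration_order sched w u.
(* If the read of [t] started before the writes of [u] ended, the later of the two starts would lie
   in both processing intervals. That [u] starts before [t] ends follows from the labels. *)
exists (Num.max (read_start X t w) (read_start X u w)).
have ut' : (u <= t)%N by lia.
have lab := after_read_labels sched w ut'.
rewrite /processed_at !le_max !ge_max !lexx !orbT/=; split; apply/andP; split; lra.
Qed.

(** [shared] sums over the whole epoch, future labels included. Since those writes are not seen, the
    sum stops before [j], and the reads become a recursion on labels. *)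
Lemma xhatE k j w v : (j < m)%N ->
  xhat X (k * m + j) w ord0 v = xt k w ord0 v -
  \sum_(0 <= u < j) (if (v \in gsupp f (idx X (k * m + u) w)) &&
     (write_at X (k * m + u) v w < read_at X (k * m + j) v w)
     then gamma * g (k * m + u) w ord0 v else 0).
Proof.
move=> jm; rewrite (xhat_read HX) epochE// /shared; congr (_ - _).
rewrite -{1}[(k * m)%N]add0n big_addn mulSn addnK big_mkcond/=.
rewrite (@big_cat_nat _ _ _ j)//=; last exact: ltnW.
rewrite [X in _ + X]big1_seq ?addr0; last first.
  move=> u /andP[_]; rewrite mem_index_iota => /andP[ju _].
  by case: ifP => // /andP[uv]; rewrite write_not_seen// addnC leq_add2r.
by apply: eq_bigr => u _; rewrite addnC.
Qed.

Lemma finite_range_xt k :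
  (forall u, (u < k * m)%N -> finite_set (range (xhat X u))) ->
  finite_set (range (xt k)).
Proof.
case: k => [|k] fX.
  by apply: sub_finite_set (finite_set1 x0) => _ [w _ <-].
(* The randomly indexed read is written as a sum over fixed positions in which only the picked one
   contributes. *)
rewrite (_ : xt _ = fun w => \sum_(p < m)
    (fun a => if p == a.1 then a.2 else 0) (pick X k w, xhat X (k * m + p) w)).
  apply: finite_range_sum => p.
  apply: (finite_range_comp (fun a => if p == a.1 then a.2 else 0)).
  apply: finite_range_pair; first exact: finite_finset.
  by apply: fX; rewrite mulSn addnC ltn_add2r.
by apply/funext => w; rewrite -big_mkcond/= big_pred1_eq.
Qed.

Lemma finite_range_xhat t : finite_set (range (xhat X t)).
Proof.
elim/ltn_ind: t => t IH; rewrite (divn_eq t m) in IH *.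
set k := (t %/ m)%N in IH *; set j := (t %% m)%N in IH *.
have jm : (j < m)%N by rewrite ltn_mod.
have fx : finite_set (range (xt k)).
  by apply: finite_range_xt => u uk; apply: IH; lia.
have fi u : finite_set (range (idx X u)) by exact: finite_finset.
apply: finite_range_row => v; under eq_fun do rewrite xhatE//.
have fs : finite_set (range (fun w => \sum_(u < j)
  (if (v \in gsupp f (idx X (k * m + u) w)) &&
     (write_at X (k * m + u) v w < read_at X (k * m + j) v w)
     then gamma * g (k * m + u) w ord0 v else 0))).
  apply: finite_range_sum => u.
  have uj : (k * m + u < k * m + j)%N by rewrite ltn_add2l.
  have um : (u < m)%N by apply: ltn_trans jm.
  (* The instants may take infinitely many values, but they enter only through this boolean. *)
  have fb : finite_set (range (fun w =>
      (v \in gsupp f (idx X (k * m + u) w)) &&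
      (write_at X (k * m + u) v w < read_at X (k * m + j) v w))).
    exact: finite_finset.
  have fg : finite_set (range (g (k * m + u))).
    rewrite /dir epochE//.
    exact: (finite_range_comp (fun a => svrg_dir f a.1.1 a.1.2 a.2)
      (finite_range_pair (finite_range_pair (fi (k * m + u)%N) (IH _ uj)) fx)).
  exact (finite_range_comp
    (fun a : bool * 'rV[R]_d => if a.1 then gamma * a.2 ord0 v else 0)
    (finite_range_pair fb fg)).
under eq_fun do rewrite big_mkord.
exact (finite_range_comp (fun a : 'rV[R]_d * R => a.1 ord0 v - a.2)
  (finite_range_pair fx fs)).
Qed.

Lemma rv_xhat t : rv (xhat X t).
Proof.
apply: simple_row => v; split.
  exact (finite_range_comp (fun x : 'rV[R]_d => x ord0 v) (finite_range_xhat t)).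
move=> y; rewrite measurable_sigma -[X in measurable X]setTI.
exact: (xhat_measurable HX).
Qed.

Lemma rv_idx t : rv (idx X t).
Proof.
by apply: simple_fin => j; rewrite measurable_sigma; exact: (idx_measurable HX).
Qed.

Lemma rv_xt k : rv (xt k).
Proof.
case: k => [|k]; first exact: simple_cst.
have sp : rv (pick X k).
  by apply: simple_fin => j; rewrite measurable_sigma; exact: (pick_measurable HX).
rewrite (_ : xt _ = fun w => \sum_(p < m)
    (fun a b => if p == a then b else 0) (pick X k w) (xhat X (k * m + p) w)).
  apply: simple_sum => p.
  exact (simple_comp2 (fun (a : 'I_m) (b : 'rV[R]_d) => if p == a then b else 0)
    sp (rv_xhat (k * m + p))).
by apply/funext => w; rewrite -big_mkcond/= big_pred1_eq.
Qed.

Lemma simple_svrg_dir G t k : simple G (idx X t) -> simple G (xhat X t) ->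
  simple G (xt k) -> (t %/ m)%N = k -> simple G (g t).
Proof.
move=> si sx st tk; rewrite /dir tk.
exact (simple_comp2 (fun (a : 'I_n * 'rV[R]_d) b => svrg_dir f a.1 a.2 b)
  (simple_pair si sx) st).
Qed.

Lemma rv_g t : rv (g t).
Proof.
by apply: (@simple_svrg_dir _ t (t %/ m)%N) => //;
  [exact: rv_idx | exact: rv_xhat | exact: rv_xt].
Qed.

Lemma history_measurable a b c : <<s history x0 X a b c >> `<=` @measurable _ T.
Proof.
apply: smallest_sub; first exact: sigma_algebra_measurable.
move=> A [[[u [v [B [_ mB ->]]]]|[u [j [_ ->]]]]|[k [v [B [_ mB ->]]]]].
- by rewrite -[X in measurable X]setTI; exact: (xhat_measurable HX).
- exact: (idx_measurable HX).
- exact (simple_measurable B (simple_comp (fun x : 'rV[R]_d => x ord0 v) (rv_xt k))).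
Qed.

Lemma history_xhat a b c u : (u < a)%N -> simple (history x0 X a b c) (xhat X u).
Proof.
move=> ua; apply: simple_row => v; split.
  exact (finite_range_comp (fun x : 'rV[R]_d => x ord0 v) (finite_range_xhat u)).
move=> y; apply: sub_sigma_algebra; left; left; exists u, v, [set y]; split => //.
Qed.

Lemma history_idx a b c u : (u < b)%N -> simple (history x0 X a b c) (idx X u).
Proof.
move=> ub; apply: simple_fin => j.
by apply: sub_sigma_algebra; left; right; exists u, j.
Qed.

Lemma history_xt a b c k : (k < c)%N -> simple (history x0 X a b c) (xt k).
Proof.
move=> kc; apply: simple_row => v; split.
  exact (finite_range_comp (fun x : 'rV[R]_d => x ord0 v) (rv_xt k).1).
move=> y; apply: sub_sigma_algebra; right; exists k, v, [set y]; split => //.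
Qed.

End Run.

(** * One epoch *)

Lemma window_count (m tau : nat) (p : nat -> bool) (a : nat) :
  (forall u, p u -> (a <= u < a + tau)%N) ->
  (\sum_(0 <= u < m | p u) 1 <= tau)%N.
Proof.
move=> pq; rewrite sum1_count -size_filter -[leqRHS](size_iota a).
apply: uniq_leq_size; first by rewrite filter_uniq// iota_uniq.
by move=> u; rewrite mem_filter mem_iota => /andP[/pq].
Qed.

(** Each index belongs to at most [tau] overlapping pairs as the later element and to at most [tau]
    as the earlier one. *)
Lemma window_sum (R : realType) (m tau : nat) (G : nat -> R) :
  (forall j, 0 <= G j) ->
  \sum_(0 <= j < m) \sum_(0 <= u < j | (j <= u + tau)%N) (G j + G u) <=
  2 * tau%:R * \sum_(0 <= j < m) G j.
Proof.
move=> G0.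
(* The constraint [u < j] moves from the range to the predicate, so that the two sums can be
   exchanged. *)
have wide j : (j < m)%N -> \sum_(0 <= u < j | (j <= u + tau)%N) (G j + G u) =
    \sum_(0 <= u < m | (u < j <= u + tau)%N) G j +
    \sum_(0 <= u < m | (u < j <= u + tau)%N) G u.
  move=> jm; rewrite -big_split/= (@big_cat_nat _ _ _ j _ m)//=; last exact: ltnW.
  rewrite [X in _ = _ + X]big_nat_cond [X in _ = _ + X]big_pred0 ?addr0; last first.
    by move=> u; lia.
  by rewrite big_nat_cond [RHS]big_nat_cond; apply: eq_bigl => u; lia.
have -> : \sum_(0 <= j < m) \sum_(0 <= u < j | (j <= u + tau)%N) (G j + G u) =
  \sum_(0 <= j < m) \sum_(0 <= u < m | (u < j <= u + tau)%N) G j +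
  \sum_(0 <= j < m) \sum_(0 <= u < m | (u < j <= u + tau)%N) G u.
  by rewrite -big_split/=; apply: eq_big_nat => j jm; exact: wide.
have le1 (p : nat -> bool) a (x : R) : 0 <= x ->
    (forall u, p u -> (a <= u < a + tau)%N) ->
    \sum_(0 <= u < m | p u) x <= tau%:R * x.
  move=> x0 pa; rewrite (eq_bigr (fun=> 1%:R * x)); last by move=> *; rewrite mul1r.
  by rewrite -mulr_suml -natr_sum ler_wpM2r// ler_nat; exact: window_count pa.
rewrite (_ : 2 * tau%:R = tau%:R + tau%:R); last by ring.
rewrite mulrDl; apply: lerD.
  rewrite mulr_sumr; apply: ler_sum => j _.
  by apply: (le1 _ (j - tau)%N) => // u; lia.
rewrite (exchange_big_dep xpredT)//= mulr_sumr; apply: ler_sum => u _.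
by apply: (le1 _ u.+1) => // j; lia.
Qed.

Section Epoch.
Variables (R : realType) (d n : nat) (f : 'I_n -> 'rV[R]_d -> R).
Variables (gamma : R) (m : nat) (x0 : 'rV[R]_d).
Variables (disp : measure_display) (T : measurableType disp).
Variables (P : probability T R) (X : run R d n m T).
Variables (L : R) (tau : nat) (xs : 'rV[R]_d).
Hypothesis HX : kromagnon f gamma x0 P X.
Hypothesis overlap : bounded_overlap X tau.
Hypotheses (m0 : (0 < m)%N) (n0 : (0 < n)%N) (gamma0 : 0 <= gamma) (L0 : 0 < L).
Hypothesis df : forall i x, differentiable (f i) x.
Hypothesis cvx : forall i, convex_function setT (f i).
Hypothesis lip : forall i, lipschitz_grad L (f i).
Hypothesis xs_min : forall x, avg f xs <= avg f x.
Hypothesis Delta0 : 0 < sparsity f.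

Notation xt := (xtilde x0 X).
Notation g := (dir f x0 X).
Notation rv := (simple (@measurable _ T)).
Notation Ex := (Ex P).
Notation s := (Num.sqrt (sparsity f)).

Lemma sqrt_sparsity_gt0 : 0 < s. Proof. by rewrite sqrtr_gt0. Qed.

Section OneEpoch.
Variable k : nat.
Notation t j := (k * m + j)%N.

Definition virtual (j : nat) (w : T) : 'rV[R]_d :=
  xt k w - gamma *: \sum_(0 <= u < j) g (t u) w.

Lemma dir_notin_gsupp u w v :
  v \notin gsupp f (idx X u w) -> g u w ord0 v = 0.
Proof. exact: svrg_dir_notin_gsupp. Qed.

(** Updates older than [tau] have certainly been read and cancel; a more recent one is either read
    or missed. Absolute values per coordinate absorb the 0/1 matrices [G_u^t]. *)
Lemma xhat_sub_virtual j w v : (j < m)%N ->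
  `|(xhat X (t j) w - virtual j w) ord0 v| <=
  gamma * \sum_(0 <= u < j | (j <= u + tau)%N) `|g (t u) w ord0 v|.
Proof.
move=> jm; rewrite row_subE (xhatE HX)// /virtual row_subE mxE summxE mulr_sumr.
rewrite opprB addrC addrA subrK -sumrB mulr_sumr [leRHS]big_mkcond/=.
apply: le_trans (ler_norm_sum _ _ _) _; apply: ler_sum => u _.
have [ju|ju] := leqP j (u + tau)%N.
  rewrite -[in leRHS](ger0_norm gamma0) -normrM.
  by case: ifP => _; rewrite ?subrr ?normr0 ?subr0.
case: (boolP (v \in gsupp f (idx X (t u) w))) => vu /=.
  rewrite (write_seen HX m0 overlap)//; last by lia.
  by rewrite subrr normr0.
by rewrite subr0 dir_notin_gsupp// mulr0 normr0.
Qed.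

(** AM-GM on each coordinate of [S], with weight [s], the root of Delta: averaging the second sum
    over a random support brings a factor [s ^+ 2], after which both terms have weight [s]. *)
Lemma cross_term_le (S : {set 'I_d}) (x y : 'rV[R]_d) :
  (forall v, v \notin S -> y ord0 v = 0) ->
  2 * \sum_(v < d) `|x ord0 v| * `|y ord0 v| <=
  s * dot y y + s^-1 * \sum_(v < d | v \in S) x ord0 v ^+ 2.
Proof.
move=> yS; rewrite /dot !mulr_sumr [X in _ <= _ + X]big_mkcond -big_split/=.
apply: ler_sum => v _; case: ifPn => vS; last first.
  by rewrite yS// normr0 !mulr0 addr0.
have sp := sqrt_sparsity_gt0.
have : 0 <= s^-1 * (`|x ord0 v| - s * `|y ord0 v|) ^+ 2.
  by rewrite mulr_ge0 ?sqr_ge0// invr_ge0 ltW.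
rewrite sqrrB exprMn !real_normK ?num_real// -subr_ge0.
suff -> : s^-1 * (x ord0 v ^+ 2 - `|x ord0 v| * (s * `|y ord0 v|) *+ 2 +
    s ^+ 2 * y ord0 v ^+ 2) =
  s * (y ord0 v * y ord0 v) + s^-1 * x ord0 v ^+ 2 -
  2 * (`|x ord0 v| * `|y ord0 v|) by [].
by field; rewrite gt_eqF.
Qed.

Definition sqdist (j : nat) (w : T) : R :=
  dot (virtual j w - xs) (virtual j w - xs).

(** The part of the squared length of [g_u] that lies on the support sampled at [j]; keeping this
    restriction is what later yields the factor Delta. *)
Definition overlap_mass (j u : nat) (w : T) : R :=
  \sum_(v < d | v \in gsupp f (idx X (t j) w)) g (t u) w ord0 v ^+ 2.

(** This holds for each outcome. In the expanded square, replacing the virtual iterate by the read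
    one costs [dot q G], where [q] is the effect of missed overlapping updates; [cross_term_le]
    treats them one by one. *)
Lemma sqdist_step j w : (j < m)%N ->
  sqdist j.+1 w <= sqdist j w +
    (- (2 * gamma) * dot (xhat X (t j) w - xs) (g (t j) w) +
     (gamma ^+ 2 * dot (g (t j) w) (g (t j) w) +
      gamma ^+ 2 * \sum_(0 <= u < j | (j <= u + tau)%N)
        (s * dot (g (t j) w) (g (t j) w) + s^-1 * overlap_mass j u w))).
Proof.
move=> jm; set G := g (t j) w; set p := virtual j w - xs.
pose q := xhat X (t j) w - virtual j w.
have vE : virtual j.+1 w - xs = p - gamma *: G.
  rewrite /virtual big_nat_recr//= -/G /p /virtual scalerDr opprD addrA.
  by rewrite [RHS]addrAC.
have xE : xhat X (t j) w - xs = q + p by rewrite /q /p addrA subrK.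
rewrite /sqdist vE xE -/p; clearbody p => {vE xE}.
have -> : dot (p - gamma *: G) (p - gamma *: G) =
    dot p p - 2 * gamma * dot p G + gamma ^+ 2 * dot G G.
  by rewrite !dotBl !dotBr !dotZl !dotZr (dotC G p); ring.
rewrite dotDl.
suff : 2 * gamma * dot q G <= gamma ^+ 2 *
    \sum_(0 <= u < j | (j <= u + tau)%N) (s * dot G G + s^-1 * overlap_mass j u w).
  by move=> H; lra.
rewrite (mulrC 2) expr2 -!mulrA ler_wpM2l//.
have H : dot q G <= gamma * \sum_(0 <= u < j | (j <= u + tau)%N)
    \sum_(v < d) `|g (t u) w ord0 v| * `|G ord0 v|.
  rewrite exchange_big/= mulr_sumr; apply: ler_sum => v _.
  rewrite -mulr_suml mulrA; apply: le_trans (ler_norm _) _.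
  by rewrite normrM ler_wpM2r//; exact: xhat_sub_virtual.
apply: (@le_trans _ _ (2 * (gamma * \sum_(0 <= u < j | (j <= u + tau)%N)
    \sum_(v < d) `|g (t u) w ord0 v| * `|G ord0 v|))).
  by rewrite ler_pM2l.
rewrite mulrCA ler_wpM2l// mulr_sumr; apply: ler_sum => u _.
by apply: cross_term_le => v; exact: dir_notin_gsupp.
Qed.


Lemma rv_virtual j : rv (virtual j).
Proof.
have sg : rv (fun w => \sum_(0 <= u < j) g (t u) w).
  by apply: simple_sum => u; exact (rv_g HX m0 (t u)).
exact (simple_comp2 (fun a b : 'rV[R]_d => a - gamma *: b) (rv_xt HX m0 k) sg).
Qed.

Lemma rv_sqdist j : rv (sqdist j).
Proof.
exact (simple_comp (fun a : 'rV[R]_d => dot (a - xs) (a - xs)) (rv_virtual j)).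
Qed.

Lemma rv_sqg u : rv (fun w => dot (g u w) (g u w)).
Proof. exact (simple_comp (fun a : 'rV[R]_d => dot a a) (rv_g HX m0 u)). Qed.

Lemma rv_avg_xhat u : rv (fun w => avg f (xhat X u w)).
Proof. exact (simple_comp (avg f) (rv_xhat HX m0 u)). Qed.

Lemma rv_avg_xt : rv (fun w => avg f (xt k w)).
Proof. exact (simple_comp (avg f) (rv_xt HX m0 k)). Qed.

Lemma rv_overlap_mass j u : rv (overlap_mass j u).
Proof.
exact (simple_comp2 (fun (i : 'I_n) (x : 'rV[R]_d) =>
  \sum_(v < d | v \in gsupp f i) x ord0 v ^+ 2) (rv_idx HX (t j)) (rv_g HX m0 (t u))).
Qed.

(** The history includes the read [u] itself but not the index [u], so [Z] may depend on the
    inconsistent read. *)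
Lemma Ex_idx (W : choiceType) (Phi : 'I_n -> W -> R) (Z : T -> W) u :
  simple (history x0 X u.+1 u (u %/ m).+1) Z ->
  Ex (fun w => Phi (idx X u w) (Z w)) =
  Ex (fun w => n%:R^-1 * \sum_(i < n) Phi i (Z w)).
Proof.
move=> sZ; have hm := history_measurable HX m0 (a := u.+1) (b := u) (c := (u %/ m).+1).
have sF i : simple (history x0 X u.+1 u (u %/ m).+1) (fun w => Phi i (Z w)).
  exact (simple_comp (Phi i) sZ).
have im i : measurable (idx X u @^-1` [set i]) by exact: (idx_measurable HX).
have iu : uniform_on P (idx X u) by exact: (idx_uniform HX).
have ii : indep_of P (idx X u) (history x0 X u.+1 u (u %/ m).+1).
  exact: (idx_indep HX).
rewrite (Ex_uniform_indep hm im iu ii sF) card_ord.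
rewrite ExZ; last by apply: simple_sum => i; exact (simple_rv hm (sF i)).
by rewrite Ex_sum// => i; exact (simple_rv hm (sF i)).
Qed.

Lemma dirE j w : (j < m)%N ->
  g (t j) w = svrg_dir f (idx X (t j) w) (xhat X (t j) w) (xt k w).
Proof. by move=> jm; rewrite /dir epochE. Qed.

Definition read_gap (j : nat) : R := Ex (fun w => avg f (xhat X (t j) w)) - avg f xs.
Definition epoch_gap : R := Ex (fun w => avg f (xt k w)) - avg f xs.
Definition second_moment (j : nat) : R := Ex (fun w => dot (g (t j) w) (g (t j) w)).

(** * Expected progress at a fixed position of the epoch *)

Section Position.
Variable j : nat.
Hypothesis jm : (j < m)%N.

Let hist := history x0 X (t j).+1 (t j) (t j %/ m).+1.

Let hist_pair : simple hist (fun w => (xhat X (t j) w, xt k w)).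
Proof.
apply: simple_pair; first by apply: (history_xhat HX m0).
by apply: (history_xt HX m0); rewrite epochE.
Qed.

(** Averaging the index turns the direction into the full gradient at the read point, where the
    tangent inequality towards [xs] applies. *)
Lemma Ex_descent :
  read_gap j <= Ex (fun w => dot (xhat X (t j) w - xs) (g (t j) w)).
Proof.
have -> : Ex (fun w => dot (xhat X (t j) w - xs) (g (t j) w)) =
    Ex (fun w => dot (xhat X (t j) w - xs) (grad (avg f) (xhat X (t j) w))).
  under eq_Ex do rewrite dirE//.
  rewrite (Ex_idx (fun i (a : 'rV[R]_d * 'rV[R]_d) =>
    dot (a.1 - xs) (svrg_dir f i a.1 a.2)) hist_pair).
  by apply: eq_Ex => w; rewrite mean_svrg_dir.
rewrite /read_gap -(Ex_cst P (avg f xs)) -ExB; last exact: simple_cst.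
apply: ler_Ex.
- exact (simple_comp (fun x => avg f x - avg f xs) (rv_xhat HX m0 (t j))).
- exact (simple_comp (fun x => dot (x - xs) (grad (avg f) x)) (rv_xhat HX m0 (t j))).
- move=> w; have := avg_ge_tangent df (xhat X (t j) w) xs cvx.
  by rewrite dotBr dotBl !(dotC (grad _ _)) => ?; lra.
- exact: rv_avg_xhat.
Qed.

Lemma second_moment_le :
  second_moment j <= 4 * L * read_gap j + 4 * L * epoch_gap.
Proof.
rewrite /second_moment; under eq_Ex do rewrite dirE//.
rewrite (Ex_idx (fun i (a : 'rV[R]_d * 'rV[R]_d) =>
    dot (svrg_dir f i a.1 a.2) (svrg_dir f i a.1 a.2)) hist_pair).
have sx := rv_avg_xhat (t j); have st := rv_avg_xt.
have sc : rv (fun=> avg f xs) by exact: simple_cst.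
have sBx : rv (fun w => avg f (xhat X (t j) w) - avg f xs).
  exact (simple_comp2 (fun a b : R => a - b) sx sc).
have sBt : rv (fun w => avg f (xt k w) - avg f xs).
  exact (simple_comp2 (fun a b : R => a - b) st sc).
rewrite /read_gap /epoch_gap -(Ex_cst P (avg f xs)) -!ExB// -!ExZ//.
rewrite -ExD; [|exact (simple_comp ( *%R (4 * L)) sBx)
              |exact (simple_comp ( *%R (4 * L)) sBt)].
apply: ler_Ex.
- apply: (simple_rv (history_measurable HX m0 (a := (t j).+1) (b := t j)
    (c := (t j %/ m).+1))).
  exact (simple_comp (fun a : 'rV[R]_d * 'rV[R]_d => n%:R^-1 * \sum_(i < n)
    dot (svrg_dir f i a.1 a.2) (svrg_dir f i a.1 a.2)) hist_pair).
- exact (simple_comp2 (fun a b : R => 4 * L * a + 4 * L * b) sBx sBt).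
- by move=> w /=; apply: mean_svrg_dir_sqr.
Qed.

(** As [u < j], the direction [g_u] belongs to the history of read [j], so the support sampled at
    [j] is independent of it and [mean_gsupp_sqr_le] applies. *)
Lemma Ex_overlap_mass u : (u < j)%N ->
  Ex (overlap_mass j u) <= s ^+ 2 * second_moment u.
Proof.
move=> uj; have hg : simple hist (g (t u)).
  apply: (@simple_svrg_dir _ _ _ f m x0 _ T X hist (t u) k).
  - by apply: history_idx; rewrite ltn_add2l.
  - by apply: (history_xhat HX m0); rewrite ltnS leq_add2l ltnW.
  - by apply: (history_xt HX m0); rewrite epochE.
  - by rewrite epochE//; exact: ltn_trans jm.
rewrite (Ex_idx (fun i (x : 'rV[R]_d) =>
  \sum_(v < d | v \in gsupp f i) x ord0 v ^+ 2) hg).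
rewrite /second_moment -ExZ; last exact: rv_sqg.
apply: ler_Ex.
- exact (simple_comp (fun x : 'rV[R]_d => n%:R^-1 * \sum_(i < n)
    \sum_(v < d | v \in gsupp f i) x ord0 v ^+ 2) (rv_g HX m0 (t u))).
- exact (simple_comp (fun x : 'rV[R]_d => s ^+ 2 * dot x x) (rv_g HX m0 (t u))).
- by move=> w; rewrite (sqr_sqrtr (ltW Delta0)); exact: mean_gsupp_sqr_le.
Qed.

Lemma Ex_sqdist_step :
  Ex (sqdist j.+1) <= Ex (sqdist j) - 2 * gamma * read_gap j +
    gamma ^+ 2 * second_moment j +
    gamma ^+ 2 * s * \sum_(0 <= u < j | (j <= u + tau)%N)
      (second_moment j + second_moment u).
Proof.
have sI : rv (fun w => dot (xhat X (t j) w - xs) (g (t j) w)).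
  exact (simple_comp2 (fun x y => dot (x - xs) y) (rv_xhat HX m0 (t j))
    (rv_g HX m0 (t j))).
have sG := rv_sqg (t j).
have sF u : rv (fun w => s * dot (g (t j) w) (g (t j) w) + s^-1 * overlap_mass j u w).
  exact (simple_comp2 (fun a b : R => s * a + s^-1 * b) sG (rv_overlap_mass j u)).
have sS : rv (fun w => \sum_(0 <= u < j | (j <= u + tau)%N)
    (s * dot (g (t j) w) (g (t j) w) + s^-1 * overlap_mass j u w)).
  exact: simple_sum.
have sGS := simple_comp2 (fun a b : R => gamma ^+ 2 * a + gamma ^+ 2 * b) sG sS.
have sIGS := simple_comp2 (fun a b : R => - (2 * gamma) * a + b) sI sGS.
have sAll := simple_comp2 (fun a b : R => a + b) (rv_sqdist j) sIGS.
have := ler_Ex P (rv_sqdist j.+1) sAll (fun w => sqdist_step w jm).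
move=> /le_trans; apply.
rewrite ExD//; last exact: rv_sqdist.
rewrite ExD//; last exact (simple_comp ( *%R (- (2 * gamma))) sI).
rewrite ExD; [|exact (simple_comp ( *%R (gamma ^+ 2)) sG)
              |exact (simple_comp ( *%R (gamma ^+ 2)) sS)].
rewrite !ExZ// (Ex_sum P _ _ sF).
have sp := sqrt_sparsity_gt0.
have H : \sum_(0 <= u < j | (j <= u + tau)%N)
    Ex (fun w => s * dot (g (t j) w) (g (t j) w) + s^-1 * overlap_mass j u w) <=
    s * \sum_(0 <= u < j | (j <= u + tau)%N) (second_moment j + second_moment u).
  rewrite mulr_sumr big_nat_cond [leRHS]big_nat_cond.
  apply: ler_sum => u /andP[/andP[_ uj] _].
  have sO := rv_overlap_mass j u.
  rewrite ExD; [|exact (simple_comp ( *%R s) sG)|exact (simple_comp ( *%R s^-1) sO)].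
  (* The weights balance: [s^-1] times the factor [s ^+ 2] of [Ex_overlap_mass] is [s]. *)
  rewrite !ExZ// mulrDr lerD2l ler_pdivrMl// mulrA -expr2.
  exact: Ex_overlap_mass.
have Hd := Ex_descent.
have H1 : gamma * read_gap j <=
    gamma * Ex (fun w => dot (xhat X (t j) w - xs) (g (t j) w)).
  by rewrite ler_wpM2l.
have H2 := ler_wpM2l (sqr_ge0 gamma) H.
by rewrite -/(second_moment j); lra.
Qed.

End Position.


Lemma second_moment_ge0 j : 0 <= second_moment j.
Proof.
rewrite -(Ex_cst P 0); apply: ler_Ex (simple_cst _ _) (rv_sqg _) _ => w.
exact: dot_ge0.
Qed.

Lemma Ex_sqdist_ge0 j : 0 <= Ex (sqdist j).
Proof.
rewrite -(Ex_cst P 0); apply: ler_Ex (simple_cst _ _) (rv_sqdist j) _ => w.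
exact: dot_ge0.
Qed.

Lemma epoch_gap_ge0 : 0 <= epoch_gap.
Proof.
rewrite /epoch_gap subr_ge0 -(Ex_cst P (avg f xs)).
by apply: ler_Ex (simple_cst _ _) rv_avg_xt _ => w; exact: xs_min.
Qed.

Lemma Ex_sqdist_telescope J : (J <= m)%N ->
  Ex (sqdist J) <= Ex (sqdist 0) - 2 * gamma * \sum_(0 <= j < J) read_gap j +
    gamma ^+ 2 * \sum_(0 <= j < J) second_moment j +
    gamma ^+ 2 * s * \sum_(0 <= j < J) \sum_(0 <= u < j | (j <= u + tau)%N)
      (second_moment j + second_moment u).
Proof.
elim: J => [|J IH] Jm; first by rewrite !big_geq// !mulr0 !addr0 subr0.
have := Ex_sqdist_step Jm; have := IH (ltnW Jm).
by rewrite !big_nat_recr//= => H1 H2; lra.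
Qed.

(** The telescoped inequality at [m], with the final squared distance bounded below by 0;
    [window_sum] turns the overlap terms into the factor [1 + 2 * s * tau]. *)
Lemma sum_read_gap_le :
  2 * gamma * \sum_(0 <= j < m) read_gap j <=
  Ex (sqdist 0) + gamma ^+ 2 * (1 + 2 * s * tau%:R) *
    (4 * L * \sum_(0 <= j < m) read_gap j + 4 * L * m%:R * epoch_gap).
Proof.
have H := le_trans (Ex_sqdist_ge0 m) (Ex_sqdist_telescope (leqnn m)).
have W := window_sum m tau second_moment_ge0.
have sp := sqrt_sparsity_gt0.
have M : \sum_(0 <= j < m) second_moment j <=
    4 * L * \sum_(0 <= j < m) read_gap j + 4 * L * m%:R * epoch_gap.
  have -> : 4 * L * m%:R * epoch_gap = \sum_(0 <= j < m) 4 * L * epoch_gap.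
    by rewrite big_const_nat subn0 iter_addr_0 -[RHS]mulr_natr; ring.
  rewrite mulr_sumr -big_split/= big_nat [leRHS]big_nat.
  by apply: ler_sum => j /andP[_ jm]; exact: second_moment_le.
have gs : 0 <= gamma ^+ 2 * s by rewrite mulr_ge0 ?sqr_ge0 ?ltW.
have W' := ler_wpM2l gs W.
have c0 : 0 <= gamma ^+ 2 * (1 + 2 * s * tau%:R).
  by rewrite mulr_ge0 ?sqr_ge0// addr_ge0// !mulr_ge0 ?ltW.
have M' := ler_wpM2l c0 M.
by lra.
Qed.

Lemma Ex_sqdist0_le (mu : R) : 0 < mu -> strongly_convex mu (avg f) ->
  mu * Ex (sqdist 0) <= 2 * epoch_gap.
Proof.
move=> mu0 sc; have s0 := rv_sqdist 0; have st := rv_avg_xt.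
have sc0 : rv (fun=> avg f xs) by exact: simple_cst.
have sB : rv (fun w => avg f (xt k w) - avg f xs).
  exact (simple_comp2 (fun a b : R => a - b) st sc0).
rewrite /epoch_gap -(Ex_cst P (avg f xs)) -ExB// -!ExZ//; apply: ler_Ex.
- exact (simple_comp ( *%R mu) s0).
- exact (simple_comp ( *%R 2) sB).
move=> w; rewrite /sqdist /virtual big_geq// scaler0 subr0.
by have := strongly_convex_min (xt k w) sc xs_min => ?; lra.
Qed.

(** The pick is uniform and independent of all the reads of its epoch. *)
Lemma epoch_gap_nextE :
  Ex (fun w => avg f (xt k.+1 w)) - avg f xs =
  m%:R^-1 * \sum_(0 <= j < m) read_gap j.
Proof.
have hm := history_measurable HX m0 (a := (k.+1 * m)%N) (b := (k.+1 * m)%N) (c := k.+1).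
have pm i : measurable (pick X k @^-1` [set i]) by exact: (pick_measurable HX).
have pu : uniform_on P (pick X k) by exact: (pick_uniform HX).
have pi : indep_of P (pick X k) (history x0 X (k.+1 * m) (k.+1 * m) k.+1).
  exact: (pick_indep HX).
have sF (p : 'I_m) : simple (history x0 X (k.+1 * m) (k.+1 * m) k.+1)
    (fun w => avg f (xhat X (t p) w)).
  apply: (simple_comp (avg f)); apply: (history_xhat HX m0).
  by rewrite mulSn addnC ltn_add2r.
rewrite (Ex_uniform_indep hm pm pu pi sF) card_ord big_mkord /read_gap sumrB mulrBr.
by rewrite mean_cst.
Qed.

End OneEpoch.

(** * Contraction over an epoch *)

Variable mu : R.
Hypotheses (mu0 : 0 < mu) (sc : strongly_convex mu (avg f)).
Hypothesis epoch_long : mu * gamma * m%:R = 8.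
Hypothesis step_small : 2 * L * gamma * (1 + 2 * s * tau%:R) <= 8^-1.

(** With the constants 8 and 1/8 the epoch bound times [mu] reads [16 e1 <= 2 e0 + 2 (e1 + e0)],
    that is [e1 <= 2/7 e0]. *)
Lemma epoch_contraction k : epoch_gap k.+1 <= 2^-1 * epoch_gap k.
Proof.
have E0 := epoch_gap_ge0 k; have E1 := epoch_gap_ge0 k.+1.
have D := Ex_sqdist0_le k mu0 sc.
have H := sum_read_gap_le k.
have mR : 0 < m%:R :> R by rewrite ltr0n.
have SE : \sum_(0 <= j < m) read_gap k j = m%:R * epoch_gap k.+1.
  by rewrite /(epoch_gap k.+1) epoch_gap_nextE mulVKf// gt_eqF.
rewrite SE in H; clear SE.
move: (epoch_gap k) (epoch_gap k.+1) (Ex (sqdist k 0)) E0 E1 D H => e0 e1 D0 E0 E1 D H.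
have small := step_small; set Q := 1 + 2 * s * tau%:R in H small.
have H1 : 2 * (mu * gamma * m%:R) * e1 <= 2 * e0 +
    2 * (mu * gamma * m%:R) * (2 * L * gamma * Q) * (e1 + e0).
  have := ler_wpM2l (ltW mu0) H.
  rewrite mulrDr => H'.
  apply: le_trans (_ : _ <= mu * D0 + mu * (gamma ^+ 2 * Q *
      (4 * L * (m%:R * e1) + 4 * L * m%:R * e0))) _.
    by apply: le_trans H'; rewrite le_eqVlt; apply/orP; left; apply/eqP; ring.
  by apply: lerD => //; rewrite le_eqVlt; apply/orP; left; apply/eqP; ring.
rewrite epoch_long in H1.
have H2 := ler_wpM2r (addr_ge0 E1 E0) small.
by lra.
Qed.

Lemma geometric_rate k : epoch_gap k <= 2^-1 ^+ k * (avg f x0 - avg f xs).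
Proof.
elim: k => [|k IH]; first by rewrite expr0 mul1r /epoch_gap /xtilde Ex_cst.
apply: le_trans (epoch_contraction k) _.
by rewrite exprS -mulrA ler_wpM2l.
Qed.

End Epoch.

(** * The rate *)

Lemma bernoulli_ineq (R : realDomainType) (x : R) N : 0 <= x <= 1 ->
  1 - N%:R * x <= (1 - x) ^+ N.
Proof.
move=> /andP[x0 x1]; elim: N => [|N IH]; first by rewrite expr0 mul0r subr0.
rewrite exprS; apply: le_trans (ler_wpM2l _ IH); last by rewrite subr_ge0.
rewrite -natr1; have : 0 <= N%:R * x * x by rewrite !mulr_ge0.
by move=> ?; lra.
Qed.

(** * Length of an epoch under the conditions on the overlap *)

Section EpochSize.
Variables (R : realType) (K kappa s : R) (n tau m : nat).
Hypotheses (K0 : 0 < K) (kappa0 : 0 < kappa) (s0 : 0 < s) (n0 : (0 < n)%N).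
Hypothesis mE : m%:R =
  32 * kappa * (4 * (1 + 2 * s * tau%:R) * (1 + tau%:R / (16 * kappa))).
Hypothesis tau_n : tau%:R <= K * n%:R.
Hypothesis tau_s : tau%:R <= K * (1 / s) * Num.max 1 (n%:R / kappa).
Hypothesis tau_sqrt : kappa <= n%:R -> tau%:R <= Num.sqrt (n%:R * s^-1).

(** The product expands into [kappa], [tau], [s tau kappa] and [s tau^2]. If [kappa <= n], the three
    conditions on [tau] bound the last three by multiples of [n]. Otherwise [s tau <= K] and
    [tau <= K kappa] bound both factors. *)
Lemma epoch_size_le :
  m%:R <= 128 * (2 + 3 * K + K ^+ 2) * Num.max n%:R kappa.
Proof.
have nR : 0 < n%:R :> R by rewrite ltr0n.
have t0 : 0 <= tau%:R :> R by [].
have mE' : m%:R = 128 * ((1 + 2 * s * tau%:R) * (kappa + tau%:R / 16)).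
  by rewrite mE; field; rewrite gt_eqF.
rewrite mE' -[leRHS]mulrA ler_pM2l//.
move: (tau%:R) t0 tau_n tau_s tau_sqrt => t t0 Hn Hs Hr.
have [kn|nk] := leP kappa n%:R.
  have Hs' : s * t * kappa <= K * n%:R.
    have max_nk : Num.max 1 (n%:R / kappa) = n%:R / kappa.
      by apply/max_idPr; rewrite ler_pdivlMr ?mul1r.
    rewrite max_nk in Hs.
    have := ler_wpM2l (ltW (mulr_gt0 s0 kappa0)) Hs.
    have -> : s * kappa * (K * (1 / s) * (n%:R / kappa)) = K * n%:R.
      by field; rewrite !gt_eqF.
    by rewrite mulrAC.
  have Hr' : s * t ^+ 2 <= n%:R.
    have ns0 : 0 <= n%:R * s^-1 by rewrite mulr_ge0 ?invr_ge0 ?ltW.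
    have := Hr kn; rewrite -(@ler_pXn2r _ 2) ?nnegrE ?sqrtr_ge0// sqr_sqrtr//.
    by rewrite ler_pdivlMr// mulrC.
  have Kn : 0 <= K * n%:R by rewrite mulr_ge0 ?ltW.
  have KKn : 0 <= K ^+ 2 * n%:R by rewrite mulr_ge0 ?sqr_ge0 ?ltW.
  have -> : (1 + 2 * s * t) * (kappa + t / 16) =
    kappa + t / 16 + 2 * (s * t * kappa) + s * t ^+ 2 / 8 by field.
  by lra.
have Hs' : s * t <= K.
  have max1 : Num.max 1 (n%:R / kappa) = 1.
    by apply/max_idPl; rewrite ler_pdivrMr// mul1r ltW.
  rewrite max1 mulr1 in Hs.
  have := ler_wpM2l (ltW s0) Hs.
  by have -> : s * (K * (1 / s)) = K by field; rewrite gt_eqF.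
have Ht : t <= K * kappa by apply: le_trans Hn _; rewrite ler_pM2l// ltW.
apply: (@le_trans _ _ ((1 + 2 * K) * (kappa + K * kappa / 16))).
  apply: ler_pM.
  - by rewrite addr_ge0// !mulr_ge0// ltW.
  - by rewrite addr_ge0// ?divr_ge0// ltW.
  - by rewrite lerD2l -mulrA ler_pM2l.
  - by rewrite lerD2l ler_pM2r.
have Kk : 0 <= K * kappa by rewrite mulr_ge0 ?ltW.
have KKk : 0 <= K ^+ 2 * kappa by rewrite mulr_ge0 ?sqr_ge0 ?ltW.
by lra.
Qed.

End EpochSize.

Theorem corollary18 (R : realType) (K : R) (hK : 0 < K) :
  exists2 c : R, 0 < c &
  forall (n d : nat) (f : 'I_n -> 'rV[R]_d -> R) (L mu : R)
    (xstar : 'rV[R]_d) (tau m : nat),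
  let kappa := L / mu in
  let Delta := sparsity f in
  let a := astar Delta kappa tau in
  let gamma := a / (4 * L) in
  (0 < n)%N -> (0 < d)%N -> 0 < mu ->
  (forall i, convex_function setT (f i)) ->
  (forall i x, differentiable (f i) x) ->
  (forall i, lipschitz_grad L (f i)) ->
  strongly_convex mu (avg f) ->
  (forall x, avg f xstar <= avg f x) ->
  tau%:R <= K * n%:R ->
  tau%:R <= K * (1 / Num.sqrt Delta) * Num.max 1 (n%:R / kappa) ->
  (kappa <= n%:R -> tau%:R <= Num.sqrt (n%:R * (Num.sqrt Delta)^-1)) ->
  m%:R = 32 * kappa / a ->
  exists rho : R,
    [/\ 0 < rho < 1,
        c * Num.min (1 / n%:R) (1 / kappa) <= rho &
        forall (x0 : 'rV[R]_d) (disp : measure_display)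
          (T : measurableType disp) (P : probability T R) (X : run R d n m T),
        kromagnon f gamma x0 P X -> bounded_overlap X tau ->
        forall k : nat,
          ('E_P[(fun w => avg f (xtilde x0 X k w))] - (avg f xstar)%:E <=
           ((1 - rho) ^+ (k * (2 * m + n)) * (avg f x0 - avg f xstar))%:E)%E].
Proof.
pose B := 128 * (2 + 3 * K + K ^+ 2).
have B0 : 0 < B by rewrite mulr_gt0// !addr_gt0// ?mulr_gt0// exprn_gt0.
(* With [m <= B M], where [M] is the maximum of [n] and [kappa], an epoch costs
   [2 m + n <= (2 B + 1) M]; the other factor 2 comes from [rho = 1 / (2 N)]. *)
exists (2 * (2 * B + 1))^-1; first by rewrite invr_gt0; lra.
move=> n d f L mu xs tau m kappa Delta a gamma n0 d0 mu0 cvx df lip sc xs_min.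
move=> tau_n tau_s tau_sqrt mE.
have muL := strong_convexity_le_lipschitz n0 df d0 lip sc xs_min.
have L0 : 0 < L by exact: lt_le_trans muL.
have Delta0 : 0 < Delta by exact: (sparsity_gt0 n0 df d0 mu0 sc xs_min).
have kappa0 : 0 < kappa by exact: divr_gt0.
have s0 : 0 < Num.sqrt Delta by rewrite sqrtr_gt0.
have nR : 0 < n%:R :> R by rewrite ltr0n.
pose Q := 1 + 2 * Num.sqrt Delta * tau%:R.
have Q0 : 0 < Q by rewrite ltr_pwDl// !mulr_ge0// ltW.
pose u := tau%:R / (16 * kappa).
have u0 : 0 <= u by rewrite divr_ge0// mulr_ge0// ltW.
have aE : a = (4 * Q * (1 + u))^-1 by [].
have a0 : 0 < a by rewrite aE invr_gt0 !mulr_gt0//; lra.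
have gamma0 : 0 < gamma by rewrite divr_gt0// mulr_gt0.
have mR : 0 < m%:R :> R by rewrite mE divr_gt0// mulr_gt0.
have m0 : (0 < m)%N by rewrite ltr0n in mR.
pose N := (2 * m + n)%N.
have N0 : (0 < N)%N by rewrite addn_gt0 n0 orbT.
have NR : 1 <= N%:R :> R by rewrite ler1n.
have NR0 : 0 < N%:R :> R by rewrite ltr0n.
have rho_range : 0 < (2 * N%:R : R)^-1 <= 2^-1.
  by rewrite invr_gt0 mulr_gt0//= lef_pV2 ?posrE ?mulr_gt0//; lra.
exists (2 * N%:R)^-1; split.
- by case/andP: rho_range => -> ?; lra.
- have mE' : m%:R = 32 * kappa * (4 * (1 + 2 * Num.sqrt Delta * tau%:R) *
      (1 + tau%:R / (16 * kappa))) by rewrite mE aE invrK.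
  have mB := epoch_size_le hK kappa0 s0 n0 mE' tau_n tau_s tau_sqrt.
  rewrite -/B in mB; set M := Num.max n%:R kappa in mB.
  have M0 : 0 < M by rewrite lt_max nR.
  have -> : Num.min (1 / n%:R) (1 / kappa) = M^-1.
    rewrite !mul1r /M /Num.max /Num.min ltf_pV2 ?posrE//.
    by case: ltgtP => // ->.
  rewrite -invfM lef_pV2 ?posrE ?mulr_gt0//; last by lra.
  have nM : n%:R <= M by rewrite le_max lexx.
  have -> : N%:R = 2 * m%:R + n%:R :> R by rewrite natrD natrM.
  by nra.
move=> x0 disp T P X HX ov k.
have rvx := rv_avg_xt HX m0 k.
rewrite ExE// -EFinB lee_fin.
apply: le_trans (geometric_rate HX ov m0 n0 (ltW gamma0) L0 df cvx lip xs_min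
  Delta0 mu0 sc _ _ k) _.
(* The factor [a] cancels between step size and epoch size, leaving 32 / 4. *)
- rewrite mE /gamma /kappa; field.
  by rewrite !gt_eqF.
(* The factor [Q] in [a] compensates the overlap; the factor [1 + u] only shrinks the step
   further. *)
- have -> : 2 * L * gamma * Q = (8 * (1 + u))^-1.
    rewrite /gamma aE; field.
    by rewrite !gt_eqF//; lra.
  by rewrite lef_pV2 ?posrE//; lra.
apply: ler_wpM2r; first by rewrite subr_ge0.
(* Grouping the exponent by epochs leaves [1 / 2 <= (1 - rho) ^+ N], which Bernoulli gives since
   [N * rho = 1 / 2]. *)
rewrite mulnC exprM lerXn2r// ?nnegrE ?invr_ge0// ?exprn_ge0//; last 2 first.
- by case/andP: rho_range => ? ?; lra.
apply: le_trans (bernoulli_ineq _ _); last first.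
  by case/andP: rho_range => ? ?; apply/andP; split; lra.
by rewrite invfM mulrCA mulfV ?gt_eqF// mulr1; lra.
Qed.
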